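(* Let $(R,\mathfrak{m})$ be a complete regular local ring of characteristic $p>0$. Then for any two ideals $\mathfrak{a},\mathfrak{b}$ of $R$, $$\tau(\mathfrak{a}\mathfrak{b})\subseteq\tau(\mathfrak{a})\,\tau(\mathfrak{b}).$$
   Context: $R^{\circ}$ is the set of elements of $R$ not in any minimal prime; $q$ denotes a power $p^e$ of $p$. ${}^e\!R$ is $R$ viewed as an $R$-module via the $e$-th iterated Frobenius; for an $R$-module $M$, $\mathbb{F}^e(M)={}^e\!R\otimes_R M$, an $R$-module via the left factor; $z^q:=1\otimes z\in\mathbb{F}^e(M)$ for $z\in M$; for $N\subseteq M$, $N^{[q]}_M$ is the image of $\mathbb{F}^e(N)\to\mathbb{F}^e(M)$. For an ideal $\mathfrak{a}$, $N^{*\mathfrak{a}}_M$ is the set of $z\in M$ for which there is $c\in R^{\circ}$ with $cz^q\mathfrak{a}^q\subseteq N^{[q]}_M$ for all large $q=p^e$ ($\mathfrak{a}^q$ the ordinary power). The ideal $\tau(\mathfrak{a})$ is $\bigcap_M\operatorname{Ann}_R(0^{*\mathfrak{a}}_M)$, $M$ running over all finitely generated $R$-modules; for excellent reduced rings this equals $\bigcap_{I\subseteq R}(I:I^{*\mathfrak{a}})$, $I$ running over all ideals, with $I^{*\mathfrak{a}}=I^{*\mathfrak{a}}_R$. *)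

(* Defs.v *)
From HB Require Import structures.
From mathcomp Require Import all_boot all_algebra.
From mathcomp Require Import boolp classical_sets.
From mathcomp.multinomials Require Import freeg.

Set Implicit Arguments.
Unset Strict Implicit.
Unset Printing Implicit Defensive.

Import GRing.Theory.
Local Open Scope ring_scope.
Local Open Scope classical_set_scope.
Local Open Scope quotient_scope.

(* [submodule] and [lspan] also serve for ideals, [R] being a module over
   itself via [R^o]; unlike [idealr] in [ring_quotient], the unit ideal is an
   ideal here.  *)
Definition submodule (R : comNzRingType) (V : lmodType R) (N : set V) : Prop :=
  [/\ N 0, forall x y, N x -> N y -> N (x + y) & forall a x, N x -> N (a *: x)].

Definition lspan (R : comNzRingType) (V : lmodType R) (G : set V) : set V :=
  [set x | exists n (c : 'I_n -> R) (g : 'I_n -> V),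
     (forall i, G (g i)) /\ x = \sum_(i < n) c i *: g i].

Definition fg_module (R : comNzRingType) (M : lmodType R) : Prop :=
  exists n (g : 'I_n -> M), lspan (range g) = [set: M].

Section Ideals.
Variable R : comNzRingType.
Implicit Types I J P Q : set R.

Definition ideal I : Prop := submodule (I : set R^o).

Definition generated_by I (n : nat) : Prop :=
  exists g : 'I_n -> R, I = lspan (range g : set R^o).

Definition ideal_mul I J : set R :=
  lspan ([set z | exists x y, [/\ I x, J y & z = x * y]] : set R^o).

Fixpoint ideal_exp I n : set R :=
  if n is n'.+1 then ideal_mul I (ideal_exp I n') else [set: R].

Definition prime_ideal P : Prop :=
  [/\ ideal P, ~ P 1 & forall x y, P (x * y) -> P x \/ P y].

Definition minimal_prime P : Prop :=
  prime_ideal P /\ forall Q, prime_ideal Q -> Q `<=` P -> Q = P.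

Definition maximal_ideal I : Prop :=
  [/\ ideal I, ~ I 1 & forall J, ideal J -> ~ J 1 -> I `<=` J -> J = I].

Definition noetherian : Prop :=
  forall I, ideal I -> exists n, generated_by I n.

Definition local_ring (m : set R) : Prop :=
  maximal_ideal m /\ forall I, maximal_ideal I -> I = m.

Definition prime_chain (d : nat) : Prop :=
  exists P : nat -> set R,
    (forall i, (i <= d)%N -> prime_ideal (P i)) /\
    (forall i, (i < d)%N -> P i `<` P i.+1).

Definition krull_dim (d : nat) : Prop :=
  prime_chain d /\ forall d', prime_chain d' -> (d' <= d)%N.

Definition regular_local_ring (m : set R) : Prop :=
  [/\ noetherian, local_ring m & exists2 d, krull_dim d & generated_by m d].

(* The canonical map from [R] to the inverse limit of the [R / I ^ n] is
   injective and surjective.  *)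
Definition adically_complete I : Prop :=
  (forall x, (forall n, ideal_exp I n x) -> x = 0) /\
  (forall u : nat -> R, (forall n, ideal_exp I n (u n.+1 - u n)) ->
     exists l, forall n, ideal_exp I n (l - u n)).

Definition off_minimal_primes : set R :=
  [set c | forall P, minimal_prime P -> ~ P c].

End Ideals.

(* The tensor product of ${}^e\!R$ and [M] over [R]: the free abelian group on
   pairs [(r, m)], modulo bilinearity and the balancing relation
   [(s^q r, m) = (r, s m)] with [q = p ^ e], as [s] acts on ${}^e\!R$ by
   multiplication by [s^q].  *)
Section FrobeniusFunctor.
Variables (R : comNzRingType) (p e : nat) (M : lmodType R).

Local Notation F := {freeg (R * M)%type / int}.
Implicit Types (r s : R) (m : M) (x y : F).

Inductive frob_null : F -> Prop :=
| FrobNull0 : frob_null 0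
| FrobNullB x y : frob_null x -> frob_null y -> frob_null (x - y)
| FrobNullDl r s m : frob_null (<<(r + s, m)>> - (<<(r, m)>> + <<(s, m)>>))
| FrobNullDr r m m' : frob_null (<<(r, m + m')>> - (<<(r, m)>> + <<(r, m')>>))
| FrobNullZ s r m : frob_null (<<(s ^+ (p ^ e) * r, m)>> - <<(r, s *: m)>>).

Definition frob_nullb : {pred F} := fun x => `[< frob_null x >].

Fact frob_null_zmod_closed : zmod_closed frob_nullb.
Proof.
split; first by apply/asboolP; exact: FrobNull0.
by move=> x y /asboolP hx /asboolP hy; apply/asboolP; exact: FrobNullB.
Qed.

HB.instance Definition _ := GRing.isZmodClosed.Build F frob_nullb
  frob_null_zmod_closed.

Definition frob : Type := Quotient.quot frob_nullb.
HB.instance Definition _ := Choice.on frob.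
HB.instance Definition _ := GRing.Zmodule.on frob.

Definition frob_pi : F -> frob := \pi_(Quotient.quot frob_nullb).
Definition frob_repr : frob -> F := repr (qT := Quotient.quot frob_nullb).

Definition tens r m : frob := frob_pi <<(r, m)>>.

Fact frob_piP x y : frob_pi x = frob_pi y <-> frob_null (x - y).
Proof.
split=> [/eqP h|h]; first by apply/asboolP; move: h; rewrite -Quotient.idealrBE.
by apply/eqP; rewrite -Quotient.idealrBE; apply/asboolP.
Qed.

Fact frob_reprK : cancel frob_repr frob_pi.
Proof. exact: (@reprK _ (Quotient.quot frob_nullb)). Qed.

Fact frob_piB : {morph frob_pi : x y / x - y}.
Proof. exact: (@pi_is_zmod_morphism _ _ _ (Quotient.quot frob_nullb)). Qed.

Fact frob_piD : {morph frob_pi : x y / x + y}.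
Proof.
move=> x y; rewrite -[y in LHS]opprK frob_piB -[- y]sub0r frob_piB.
by rewrite -[in frob_pi 0](subrr 0) frob_piB subrr sub0r opprK.
Qed.

Fact tensDl r s m : tens (r + s) m = tens r m + tens s m.
Proof. by rewrite -frob_piD; apply/frob_piP; exact: FrobNullDl. Qed.

Fact tensDr r m m' : tens r (m + m') = tens r m + tens r m'.
Proof. by rewrite -frob_piD; apply/frob_piP; exact: FrobNullDr. Qed.

Fact tens_frob s r m : tens (s ^+ (p ^ e) * r) m = tens r (s *: m).
Proof. by apply/frob_piP; exact: FrobNullZ. Qed.

Fact frob_ind (P : frob -> Prop) :
  P 0 -> (forall u v, P u -> P v -> P (u - v)) -> (forall r m, P (tens r m)) ->
  forall u, P u.
Proof.
move=> P0 PB Pt u; rewrite -(frob_reprK u).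
have PN v : P v -> P (- v) by move=> hv; rewrite -sub0r; exact: PB.
have PD v w : P v -> P w -> P (v + w).
  by move=> hv hw; rewrite -[w]opprK; apply: PB => //; exact: PN.
have pi0 : frob_pi 0 = 0 by rewrite -(subrr 0) frob_piB subrr.
have Pn n r m : P (frob_pi (<<(r, m)>> *+ n)).
  elim: n => [|n IH]; first by rewrite mulr0n pi0.
  by rewrite mulrS frob_piD; apply: PD => //; exact: Pt.
elim/freeg_ind_dom0: (frob_repr u) => [|k [r m] D _ _ PFD].
  by rewrite pi0.
rewrite frob_piD; apply: PD => //.
have -> : <<k *g (r, m)>> = <<(r, m)>> *~ k :> F by rewrite freegU_mulz intz.
case: k => n; first exact: Pn.
by rewrite NegzE mulrNz -[- _]sub0r frob_piB pi0 sub0r; apply/PN/Pn.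
Qed.

Section Lift.
Variables (V : zmodType) (f : R -> M -> V).
Hypothesis fDl : forall r s m, f (r + s) m = f r m + f s m.
Hypothesis fDr : forall r m m', f r (m + m') = f r m + f r m'.
Hypothesis fZ : forall s r m, f (s ^+ (p ^ e) * r) m = f r (s *: m).

Definition frob_lift (u : frob) : V :=
  fglift (M := zmodule V) (fun z : R * M => f z.1 z.2) (frob_repr u).

Let L := fglift (M := zmodule V) (fun z : R * M => f z.1 z.2).

Let LB : {morph L : x y / x - y}.
Proof. exact: lift_is_additive. Qed.

Let LU r m : L <<(r, m)>> = f r m.
Proof. by rewrite /L liftU scale1r. Qed.

Let L0 : L 0 = 0.
Proof. by rewrite -(subrr 0) LB subrr. Qed.

Let LD : {morph L : x y / x + y}.
Proof. by move=> x y; rewrite -[y in LHS]opprK LB -[- y]sub0r LB L0 sub0r opprK. Qed.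

Let L_null x : frob_null x -> L x = 0.
Proof.
elim=> [|{}x y _ Lx _ Ly|r s m|r m m'|s r m].
- exact: L0.
- by rewrite LB Lx Ly subrr.
- by rewrite LB LD !LU fDl subrr.
- by rewrite LB LD !LU fDr subrr.
- by rewrite LB !LU fZ subrr.
Qed.

Let LE x : frob_lift (frob_pi x) = L x.
Proof.
apply/eqP; rewrite -subr_eq0 -LB; apply/eqP/L_null.
by apply/frob_piP; exact: frob_reprK.
Qed.

Fact frob_lift_tens r m : frob_lift (tens r m) = f r m.
Proof. by rewrite LE LU. Qed.

Fact frob_liftB : {morph frob_lift : u v / u - v}.
Proof.
move=> u v; rewrite -[u]frob_reprK -[v]frob_reprK -frob_piB !LE; exact: LB.
Qed.

Fact frob_liftD : {morph frob_lift : u v / u + v}.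
Proof.
by move=> u v; rewrite -[u]frob_reprK -[v]frob_reprK -frob_piD !LE LD.
Qed.

End Lift.

Definition frob_scale a : frob -> frob := frob_lift (fun r m => tens (a * r) m).

Fact frob_scale_tens a r m : frob_scale a (tens r m) = tens (a * r) m.
Proof.
apply: frob_lift_tens => [s t n|s n n'|s t n]; first by rewrite mulrDr tensDl.
  exact: tensDr.
by rewrite mulrCA tens_frob.
Qed.

Fact frob_scaleB a : {morph frob_scale a : u v / u - v}.
Proof.
apply: frob_liftB => [s t n|s n n'|s t n]; first by rewrite mulrDr tensDl.
  exact: tensDr.
by rewrite mulrCA tens_frob.
Qed.

Fact frob_scale0 a : frob_scale a 0 = 0.
Proof. by rewrite -[X in frob_scale a X](subrr 0) frob_scaleB subrr. Qed.

Fact frob_scaleDr a : {morph frob_scale a : u v / u + v}.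
Proof.
move=> u v; rewrite -[v in LHS]opprK frob_scaleB -[- v]sub0r frob_scaleB.
by rewrite frob_scale0 sub0r opprK.
Qed.

Fact frob_scaleA a b u : frob_scale a (frob_scale b u) = frob_scale (a * b) u.
Proof.
elim/frob_ind: u => [|u v hu hv|r m]; first by rewrite !frob_scale0.
  by rewrite !frob_scaleB hu hv.
by rewrite !frob_scale_tens mulrA.
Qed.

Fact frob_scale1 : left_id 1 frob_scale.
Proof.
elim/frob_ind => [|u v hu hv|r m]; first by rewrite frob_scale0.
  by rewrite frob_scaleB hu hv.
by rewrite frob_scale_tens mul1r.
Qed.

Fact frob_scaleDl u : {morph frob_scale^~ u : a b / a + b}.
Proof.
move=> a b; elim/frob_ind: u => [|u v hu hv|r m].
- by rewrite !frob_scale0 addr0.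
- by rewrite !frob_scaleB hu hv opprD addrACA.
- by rewrite !frob_scale_tens mulrDl tensDl.
Qed.

HB.instance Definition _ := GRing.Zmodule_isLmodule.Build R frob
  frob_scaleA frob_scale1 frob_scaleDr frob_scaleDl.

Fact scale_tens a r m : a *: tens r m = tens (a * r) m.
Proof. exact: frob_scale_tens. Qed.

End FrobeniusFunctor.

Section TightClosure.
Variables (R : comNzRingType) (p : nat).

(* [z^q] and [N^[q]_M] for [q = p ^ e]; the elements of the image of
   $F^e(N) -> F^e(M)$ are the finite sums of tensors [r_i \otimes n_i] with
   the [n_i] in [N].  *)
Definition frob_elt e (M : lmodType R) (z : M) : frob p e M := tens p e 1 z.

Definition frob_sub e (M : lmodType R) (N : set M) : set (frob p e M) :=
  [set u | exists n (r : 'I_n -> R) (x : 'I_n -> M),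
     (forall i, N (x i)) /\ u = \sum_(i < n) tens p e (r i) (x i)].

Definition tight_closure (a : set R) (M : lmodType R) (N : set M) : set M :=
  [set z | exists2 c, off_minimal_primes c &
     exists e0, forall e, (e0 <= e)%N ->
       forall x, ideal_exp a (p ^ e) x ->
         frob_sub N (c *: (x *: frob_elt e z))].

Definition annihilator (M : lmodType R) (S : set M) : set R :=
  [set r | forall z, S z -> r *: z = 0].

Definition test_ideal (a : set R) : set R :=
  [set r | forall M : lmodType R, fg_module M ->
     annihilator (tight_closure a [set 0 : M]) r].

End TightClosure.

(* Main.v *)
(** Call an additive map [phi : R -> R] with [phi (s ^ q * r) = s * phi r] a
Cartier map.  The heart of the matter is that Cartier maps detect Frobenius
powers: if [phi f] lies in the ideal [I] for all of them, then [f] lies in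
[I^[q]].  For [q = p] every [f] has a unique convergent expansion
[f = sum_(u, a) h_(u, a) ^ p * u * x ^ a], where [x] is a regular system of
parameters, [a] runs over the exponents below [p] and the [u] lift a basis of
the residue field over its [p]-th powers; the coefficients [h_(u, a)] are
Cartier maps, and [I^[p]] is closed.  Uniqueness rests on the independence of
the monomials in [x] modulo [m]: a dependence would bound the length of
[R / (P + m ^ n)] by a polynomial in [n] of degree less than [dim R], whereas a
chain of [dim R + 1] primes and Artin-Rees force growth of order [n ^ dim R].

A Cartier map induces a map from [F^e(M)] to [M], so [r (x) z = 0] implies
[r] in [Ann(z)^[q]].  Hence [a ^ q] is contained in [tau(a)^[q]] for all [q], and
with [J = tau(a) tau(b)] the unit of [R / J] lies in the [ab]-tight closure of
[0], so that [tau(ab)] annihilates [R / J]. *)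

From HB Require Import structures.
Require Import Defs.
From mathcomp Require Import all_boot all_order all_algebra.
From mathcomp Require Import boolp classical_sets.
From mathcomp.multinomials Require Import mpoly.

Set Implicit Arguments.
Unset Strict Implicit.
Unset Printing Implicit Defensive.

Import Order.TTheory GRing.Theory.
Local Open Scope ring_scope.
Local Open Scope classical_set_scope.

(** * Spans and submodules *)

Section Spans.
Variables (R : comNzRingType) (V : lmodType R).
Implicit Types (G N : set V).

Lemma lspan_mem G x : G x -> lspan G x.
Proof.
move=> Gx; exists 1%N, (fun=> 1), (fun=> x); split=> //.
by rewrite big_ord1 scale1r.
Qed.

Lemma submodule_sum N (T : Type) (s : seq T) (P : pred T) (F : T -> V) :
  submodule N -> (forall i, P i -> N (F i)) -> N (\sum_(i <- s | P i) F i).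
Proof. by move=> [N0 ND _] NF; elim/big_ind: _. Qed.

Lemma lspan_min G N : submodule N -> G `<=` N -> lspan G `<=` N.
Proof.
move=> sN GN x [n [c [g [Gg ->]]]]; apply: submodule_sum => // i _.
by case: sN => _ _; apply; apply: GN.
Qed.

Lemma lspan_submodule G : submodule (lspan G).
Proof.
split.
- by exists 0%N, (fun=> 0), (fun=> 0); split; [case|rewrite big_ord0].
- move=> x y [n [c [g [Gg ->]]]] [n' [c' [g' [Gg' ->]]]].
  exists (n + n')%N, (fun i => match split i with inl j => c j | inr j => c' j end),
    (fun i => match split i with inl j => g j | inr j => g' j end).
  split; first by move=> i; case: (split i).
  rewrite big_split_ord; congr (_ + _); apply: eq_bigr => i _ /=.
    by rewrite -[lshift _ _]/(unsplit (inl i)) unsplitK.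
  by rewrite -[rshift _ _]/(unsplit (inr i)) unsplitK.
- move=> a x [n [c [g [Gg ->]]]]; exists n, (fun i => a * c i), g; split=> //.
  by rewrite scaler_sumr; apply: eq_bigr => i _; rewrite scalerA.
Qed.

End Spans.

(** * Sums, products, powers and colons of ideals *)

Section IdealArithmetic.
Variable R : comNzRingType.
Implicit Types (I J K : set R) (x y z r : R).

Lemma ideal0 I : ideal I -> I 0. Proof. by case. Qed.

Lemma idealD I x y : ideal I -> I x -> I y -> I (x + y).
Proof. by case=> _ + _; apply. Qed.

Lemma idealMl I r x : ideal I -> I x -> I (r * x).
Proof. by case=> _ _ /(_ r x). Qed.

Lemma idealMr I r x : ideal I -> I x -> I (x * r).
Proof. by rewrite mulrC; exact: idealMl. Qed.

Lemma idealN I x : ideal I -> I x -> I (- x).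
Proof. by move=> iI Ix; rewrite -mulN1r; apply: idealMl. Qed.

Lemma idealB I x y : ideal I -> I x -> I y -> I (x - y).
Proof. by move=> iI Ix Iy; apply: idealD => //; apply: idealN. Qed.

Lemma ideal_sum I (T : Type) (s : seq T) (P : pred T) (F : T -> R) :
  ideal I -> (forall i, P i -> I (F i)) -> I (\sum_(i <- s | P i) F i).
Proof. exact: (@submodule_sum R R^o I). Qed.

Lemma idealT : ideal [set: R]. Proof. by []. Qed.

Definition ispan (G : set R) : set R := lspan (G : set R^o).

Lemma ispan_ideal G : ideal (ispan G). Proof. exact: lspan_submodule. Qed.

Lemma ispan_mem G x : G x -> ispan G x. Proof. exact: (@lspan_mem R R^o G x). Qed.

Lemma ispan_min G I : ideal I -> G `<=` I -> ispan G `<=` I.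
Proof. exact: (@lspan_min R R^o G I). Qed.

Lemma ispanS G H : G `<=` H -> ispan G `<=` ispan H.
Proof.
move=> GH; apply: ispan_min; first exact: ispan_ideal.
by move=> x /GH; exact: ispan_mem.
Qed.

(** With one factor fixed, the other factors whose product lies in [I] form an ideal; so generators
    may be checked one factor at a time. *)
Lemma ispan_mul G H I y z : ideal I ->
  (forall g h, G g -> H h -> I (g * h)) -> ispan G y -> ispan H z -> I (y * z).
Proof.
move=> iI GH Gy Hz; move: z Hz y Gy.
pose J := [set z | forall y, ispan G y -> I (y * z)].
have iJ : ideal J.
  split=> [y _|a b Ja Jb y Gy|r a Ja y Gy].
  - by rewrite mulr0; apply: ideal0.
  - by rewrite mulrDr; apply: idealD; auto.
  - by rewrite /GRing.scale /= mulrCA; apply: idealMl; auto.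
suff: ispan H `<=` J by [].
apply: ispan_min => // h Hh y Gy; move: y Gy.
pose J' := [set y | I (y * h)].
have iJ' : ideal J'.
  split=> [|a b Ja Jb|r a Ja]; rewrite /J' /=.
  - by rewrite mul0r; apply: ideal0.
  - by rewrite mulrDl; apply: idealD; auto.
  - by rewrite /GRing.scale /= -mulrA; apply: idealMl; auto.
suff: ispan G `<=` J' by [].
by apply: ispan_min => // g Gg; apply: GH.
Qed.

Definition ideal_add I J : set R := [set z | exists2 x, I x & J (z - x)].

Lemma ideal_add_ideal I J : ideal I -> ideal J -> ideal (ideal_add I J).
Proof.
move=> iI iJ; split.
- by exists 0; [apply: ideal0|rewrite subr0; apply: ideal0].
- move=> x y [x' Ix' Jx] [y' Iy' Jy]; exists (x' + y'); first exact: idealD.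
  by rewrite opprD addrACA; apply: idealD.
- move=> a x [x' Ix' Jx]; exists (a * x'); first exact: idealMl.
  by rewrite /GRing.scale /= -mulrBr; apply: idealMl.
Qed.

Lemma ideal_addl I J : ideal J -> I `<=` ideal_add I J.
Proof. by move=> iJ x Ix; exists x => //; rewrite subrr; apply: ideal0. Qed.

Lemma ideal_addr I J : ideal I -> J `<=` ideal_add I J.
Proof. by move=> iI x Jx; exists 0; [apply: ideal0|rewrite subr0]. Qed.

Lemma ideal_add_min I J K : ideal K -> I `<=` K -> J `<=` K -> ideal_add I J `<=` K.
Proof.
move=> iK IK JK z [x /IK Kx /JK Kzx]; rewrite -(subrK x z).
exact: idealD.
Qed.

Lemma ideal_addS I I' J J' :
  I `<=` I' -> J `<=` J' -> ideal_add I J `<=` ideal_add I' J'.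
Proof. by move=> II' JJ' z [x /II' ? /JJ' ?]; exists x. Qed.

Definition principal y : set R := [set z | exists r, z = r * y].

Lemma principal_ideal y : ideal (principal y).
Proof.
split.
- by exists 0; rewrite mul0r.
- by move=> _ _ [r ->] [s ->]; exists (r + s); rewrite mulrDl.
- by move=> a _ [r ->]; exists (a * r); rewrite -mulrA.
Qed.

Lemma principal_id y : principal y y. Proof. by exists 1; rewrite mul1r. Qed.

Definition scaled I y : set R := [set z | exists2 r, I r & z = r * y].

Lemma scaled_ideal I y : ideal I -> ideal (scaled I y).
Proof.
move=> iI; split; first by exists 0; [apply: ideal0|rewrite mul0r].
  by move=> _ _ [t It ->] [s Is ->]; exists (t + s); [exact: idealD|rewrite mulrDl].
by move=> a _ [t It ->]; exists (a * t); [exact: idealMl|rewrite -mulrA].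
Qed.

Definition colon I y : set R := [set r | I (r * y)].

Lemma colon_ideal I y : ideal I -> ideal (colon I y).
Proof.
move=> iI; split; rewrite /colon /=.
- by rewrite mul0r; apply: ideal0.
- by move=> r s Ir Is; rewrite mulrDl; apply: idealD.
- by move=> a r Ir; rewrite -mulrA; apply: idealMl.
Qed.

Lemma ideal_mul_ideal I J : ideal (ideal_mul I J). Proof. exact: ispan_ideal. Qed.

Lemma ideal_mul_mem I J x y : I x -> J y -> ideal_mul I J (x * y).
Proof. by move=> Ix Jy; apply: ispan_mem; exists x, y. Qed.

Lemma ideal_mul_min I J K : ideal K ->
  (forall x y, I x -> J y -> K (x * y)) -> ideal_mul I J `<=` K.
Proof. by move=> iK H; apply: ispan_min => // _ [x [y [Ix Jy ->]]]; apply: H. Qed.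

Lemma ideal_mulS I J I' J' :
  I `<=` I' -> J `<=` J' -> ideal_mul I J `<=` ideal_mul I' J'.
Proof.
move=> II JJ; apply: ideal_mul_min; first exact: ideal_mul_ideal.
by move=> x y /II ? /JJ ?; apply: ideal_mul_mem.
Qed.

Lemma ideal_mulAC I J K L :
  ideal_mul (ideal_mul I J) (ideal_mul K L) `<=`
  ideal_mul (ideal_mul I K) (ideal_mul J L).
Proof.
have iM := ideal_mul_ideal (ideal_mul I K) (ideal_mul J L).
apply: ideal_mul_min => // x y; apply: ispan_mul => //.
move=> _ _ [x1 [x2 [Ix1 Jx2 ->]]] [y1 [y2 [Ky1 Ly2 ->]]]; rewrite mulrACA.
by apply: ideal_mul_mem; apply: ideal_mul_mem.
Qed.

Lemma ideal_exp_ideal I n : ideal (ideal_exp I n).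
Proof. by case: n => [|n]; [exact: idealT|exact: ideal_mul_ideal]. Qed.

Lemma ideal_expD I i j x y :
  ideal_exp I i x -> ideal_exp I j y -> ideal_exp I (i + j) (x * y).
Proof.
elim: i x => [|i IHi] x.
  by move=> _ ?; apply: idealMl => //; apply: ideal_exp_ideal.
move=> Ix Jy; move: x Ix.
suff: ideal_exp I i.+1 `<=` colon (ideal_exp I (i.+1 + j)) y by [].
apply: ideal_mul_min; first by apply: colon_ideal; apply: ideal_exp_ideal.
move=> a b Ia Ib; rewrite /colon /= -mulrA; apply: ideal_mul_mem => //.
exact: IHi.
Qed.

Lemma ideal_expW I n k : (n <= k)%N -> ideal_exp I k `<=` ideal_exp I n.
Proof.
move=> /subnK <-; elim: (k - n)%N => [|j IHj] //.
move=> x Hx; apply: IHj; rewrite addSn in Hx; move: x Hx; apply: ideal_mul_min.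
  exact: ideal_exp_ideal.
by move=> x y _; apply: idealMl; apply: ideal_exp_ideal.
Qed.

Lemma ideal_exp1 I x : I x -> ideal_exp I 1 x.
Proof. by move=> Ix; rewrite -[x]mulr1; apply: ideal_mul_mem. Qed.

Lemma ideal_exp1E I : ideal I -> ideal_exp I 1 = I.
Proof.
move=> iI; apply/seteqP; split; last exact: ideal_exp1.
by apply: ideal_mul_min => // x y Ix _; apply: idealMr.
Qed.

Lemma ideal_expX I i n x : ideal_exp I i x -> ideal_exp I (i * n) (x ^+ n).
Proof.
move=> Ix; elim: n => [|n IHn]; first by rewrite muln0.
by rewrite exprS mulnS; apply: ideal_expD.
Qed.

Lemma ideal_exp_mul I J n :
  ideal_exp (ideal_mul I J) n `<=` ideal_mul (ideal_exp I n) (ideal_exp J n).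
Proof.
elim: n => [|n IHn] /=.
  by move=> x _; rewrite -[x]mul1r; apply: ideal_mul_mem.
by move=> x Hx; apply: ideal_mulAC; move: x Hx; apply: ideal_mulS.
Qed.

End IdealArithmetic.

(** * Noetherian local rings and Nakayama's lemma *)

Section Noetherian.
Variable R : comNzRingType.
Hypothesis noethR : noetherian R.
Implicit Types (I J K L : set R).

Lemma ascending_chain (U : nat -> set R) :
  (forall n, ideal (U n)) -> (forall n, U n `<=` U n.+1) ->
  exists k, forall n, U n `<=` U k.
Proof.
move=> iU US.
have Ule i j : (i <= j)%N -> U i `<=` U j.
  move=> /subnK <-; elim: (j - i)%N => [|l IHl] // x /IHl.
  by rewrite addSn; apply: US.
pose W := [set x | exists n, U n x].
have iW : ideal W.
  split; first by exists 0%N; exact: ideal0 (iU _).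
    move=> x y [i Ux] [j Uy]; exists (maxn i j); apply: (idealD (iU _)).
      exact: Ule _ _ (leq_maxl _ _) _ Ux.
    exact: Ule _ _ (leq_maxr _ _) _ Uy.
  by move=> a x [i Ux]; exists i; apply: idealMl (iU _) Ux.
have [n [g Wg]] := noethR iW.
have Wgi i : exists k, U k (g i).
  by have: W (g i) by rewrite Wg; apply: ispan_mem; exists i.
have [k Uk] := choice Wgi.
exists (\max_i k i) => j x Ujx.
have : W x by exists j.
rewrite Wg; apply: (@ispan_min R (range g) _ (iU _)) => _ [i _ <-].
exact: Ule _ _ (leq_bigmax i) _ (Uk i).
Qed.

(** If every member above [I] had a strictly larger one, choice would iterate this into an ascending
    chain that never stabilises. *)
Lemma maximal_member (P : set (set R)) I :
  (forall J, P J -> ideal J) -> P I ->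
  exists L, [/\ P L, I `<=` L & forall J, P J -> L `<=` J -> J `<=` L].
Proof.
move=> Pideal PI; apply: contrapT => noL.
have next (J : {J | P J /\ I `<=` J}) : exists J' : {J | P J /\ I `<=` J},
    sval J `<=` sval J' /\ ~ (sval J' `<=` sval J).
  case: J => J /= [PJ IJ]; apply: contrapT => nonext; apply: noL.
  exists J; split=> // J' PJ' JJ'; apply: contrapT => nJJ; apply: nonext.
  by exists (exist _ J' (conj PJ' (subset_trans IJ JJ'))).
have [f fP] := choice next.
pose U n := sval (iter n f (exist _ I (conj PI (@subset_refl _ I)))).
have [|n|k Uk] := @ascending_chain U.
- by move=> n; rewrite /U; case: (iter _ _ _) => /= J [/Pideal].
- by have [] := fP (iter n f (exist _ I (conj PI (@subset_refl _ I)))).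
- by have [_ []] := fP (iter k f (exist _ I (conj PI (@subset_refl _ I)))); apply: Uk k.+1.
Qed.

Variable m : set R.
Hypothesis locm : local_ring m.

Let idealm : ideal m. Proof. by case: locm => [[]]. Qed.

Lemma local_ideal : ideal m. Proof. exact: idealm. Qed.

Lemma local_proper : ~ m 1. Proof. by case: locm => [[]]. Qed.

Lemma proper_sub_max I : ideal I -> ~ I 1 -> I `<=` m.
Proof.
move=> iI I1.
have [J []//|//|L [[iL L1] IL Lmax]] :=
  @maximal_member [set J | ideal J /\ ~ J 1] I.
case: locm => _ /(_ L) <- //; split=> // J iJ J1 LJ.
by apply/seteqP; split=> //; apply: Lmax.
Qed.

Lemma local_unit c : ~ m c -> exists r, r * c = 1.
Proof.
move=> mc; have [[r ->]|c1] := EM (principal c 1); first by exists r.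
by case: mc; apply: (proper_sub_max (principal_ideal c) c1); apply: principal_id.
Qed.

Lemma local_unit1B t : m t -> exists r, r * (1 - t) = 1.
Proof.
move=> mt; apply: local_unit => m1t; apply: local_proper.
by rewrite -(subrK t 1); apply: idealD.
Qed.

(** Maximality replaces generators of [K]: let [L] be maximal among the ideals above [I] that do not
    contain [K], and [x] in [K] but not in [L]. Then [K] lies in [L + (x)], so [m K] lies in
    [L + m x], and [x] in [I + m K] gives [(1 - t) * x] in [L] with [t] in [m]. *)
Lemma nakayama I K : ideal I -> ideal K ->
  K `<=` ideal_add I (ideal_mul m K) -> K `<=` I.
Proof.
move=> iI iK KI; apply: contrapT => nKI.
have [J []//|//|L [[iL KL] IL Lmax]] :=
  @maximal_member [set J | ideal J /\ ~ (K `<=` J)] I.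
have [x Kx Lx] : exists2 x, K x & ~ L x.
  by apply: contrapT => H; apply: KL => x Kx; apply: contrapT => Lx; apply: H; exists x.
pose Lx' := ideal_add L (principal x).
have iLx : ideal Lx' by apply: ideal_add_ideal => //; apply: principal_ideal.
have LLx : L `<=` Lx' by apply: ideal_addl; apply: principal_ideal.
have KLx : K `<=` Lx'.
  apply: contrapT => KLx; apply: Lx; apply: (Lmax Lx') => //.
  by apply: ideal_addr => //; apply: principal_id.
apply: Lx.
have [y Iy mKxy] := KI x Kx.
have : ideal_add L (scaled m x) (x - y).
  have iA : ideal (scaled m x) by apply: scaled_ideal.
  move: mKxy; apply: ideal_mul_min; first exact: ideal_add_ideal.
  move=> t z mt /KLx [l Ll [r zl]].
  exists (t * l); first exact: idealMl.
  by exists (t * r); [apply: idealMr|rewrite -mulrBr zl mulrA].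
move=> [l Ll [t mt xyl]]; have [r r1] := local_unit1B mt.
rewrite -[x]mul1r -r1 -mulrA; apply: idealMl => //.
rewrite mulrBl mul1r -xyl -addrA -opprD opprB addrC subrK.
by apply: idealD => //; apply: IL.
Qed.

End Noetherian.

(** * Monomials in generators of [m] and initial exponents *)

Section Monomials.
Variables (R : comNzRingType) (d : nat) (x : 'I_d -> R).
Implicit Types (b g : 'X_{1..d}) (S : set 'X_{1..d}) (I J U V : set R).

Definition monom b : R := \prod_i x i ^+ b i.

Lemma monomD b g : monom (b + g)%MM = monom b * monom g.
Proof.
by rewrite /monom -big_split; apply: eq_bigr => i _; rewrite mnmDE exprD.
Qed.

Lemma monom0 : monom 0%MM = 1.
Proof. by rewrite /monom big1 // => i _; rewrite mnm0E. Qed.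

Lemma monom1 i : monom U_(i)%MM = x i.
Proof.
rewrite /monom (bigD1 i) //= mnm1E eqxx expr1 big1 ?mulr1 // => j ji.
by rewrite mnm1E eq_sym (negbTE ji).
Qed.

Definition mono S : set R := ispan (monom @` S).

Lemma mono_ideal S : ideal (mono S). Proof. exact: ispan_ideal. Qed.

Lemma mono_mem S b : S b -> mono S (monom b).
Proof. by move=> Sb; apply: ispan_mem; exists b. Qed.

Lemma monoS S S' : S `<=` S' -> mono S `<=` mono S'.
Proof. by move=> SS'; apply: ispanS; exact: image_subset. Qed.

Lemma mono_min S I : ideal I -> (forall b, S b -> I (monom b)) -> mono S `<=` I.
Proof. by move=> iI SI; apply: ispan_min => // _ [b /SI ? <-]. Qed.

(** The order on exponents refines the degree, so every monomial of larger degree is included. *)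
Definition mono_gt b := mono [set g | (b < g)%O].

Variable m : set R.
Hypothesis genm : m = ispan (range x).

Let idealm : ideal m. Proof. by rewrite genm; exact: ispan_ideal. Qed.

Let mx i : m (x i). Proof. by rewrite genm; apply: ispan_mem; exists i. Qed.

Lemma monom_exp b : ideal_exp m (mdeg b) (monom b).
Proof.
rewrite mdegE /monom.
apply: (big_rec2 (fun n y => ideal_exp m n y)) => // i y n _; apply: ideal_expD.
by have := ideal_expX (b i) (ideal_exp1 (mx i)); rewrite mul1n.
Qed.

Lemma exp_mono n : ideal_exp m n `<=` mono [set b | mdeg b = n].
Proof.
elim: n => [|n IHn] /=.
  by move=> y _; rewrite -[y]mulr1 -monom0; apply: (idealMl _ (mono_ideal _));
    apply: mono_mem; rewrite /= mdeg0.
apply: ideal_mul_min; first exact: mono_ideal.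
move=> y z my /IHn; rewrite genm in my; move: my.
apply: ispan_mul; first exact: mono_ideal.
move=> _ _ [i _ <-] [b <- <-]; rewrite -monom1 -monomD; apply: mono_mem.
by rewrite /= mdegD mdeg1.
Qed.

Lemma mono_exp n S : (forall b, S b -> (n <= mdeg b)%N) -> mono S `<=` ideal_exp m n.
Proof.
move=> Sn; apply: mono_min => [|b /Sn nb]; first exact: ideal_exp_ideal.
by apply: ideal_expW nb _ _; apply: monom_exp.
Qed.

(** The bound [N] makes the exponents range over a finite type; only those of degree [n] enter the
    sum. *)
Lemma exp_homogeneous n N y : (n < N)%N -> ideal_exp m n y ->
  exists c : 'X_{1..d} -> R,
    y = \sum_(b : 'X_{1..d < N} | mdeg b == n) c b * monom b.
Proof.
move=> nN /exp_mono; move: y.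
pose J := [set y | exists c : 'X_{1..d} -> R,
  y = \sum_(b : 'X_{1..d < N} | mdeg b == n) c b * monom b].
suff: mono [set b | mdeg b = n] `<=` J by [].
apply: mono_min => [|b /= bn].
  split.
  - by exists (fun=> 0); rewrite big1 // => b _; rewrite mul0r.
  - move=> _ _ [c ->] [c' ->]; exists (fun b => c b + c' b).
    by rewrite -big_split; apply: eq_bigr => b _; rewrite mulrDl.
  - move=> a _ [c ->]; exists (fun b => a * c b).
    by rewrite /GRing.scale /= mulr_sumr; apply: eq_bigr => b _; rewrite mulrA.
exists (fun g => (g == b)%:R).
have bP : (mdeg b < N)%N by rewrite bn.
rewrite (bigD1 (BMultinom bP)) /=; last by rewrite bn.
rewrite eqxx mul1r big1 ?addr0 // => g /andP[_ gb].
by rewrite -(bmeqP g (BMultinom bP)) (negbTE gb) mul0r.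
Qed.

Lemma max_monom_gt t b : m t -> mono_gt b (t * monom b).
Proof.
have iC := colon_ideal (monom b) (mono_ideal [set g | (b < g)%O]).
move: t; suff: m `<=` colon (mono_gt b) (monom b) by [].
rewrite genm; apply: ispan_min => // _ [i _ <-]; rewrite /colon /=.
rewrite -monom1 -monomD; apply: mono_mem => /=.
by apply: lt_mdeg_ltmc; rewrite mdegD mdeg1.
Qed.

Lemma exp_mono_gt n b : (mdeg b < n)%N -> ideal_exp m n `<=` mono_gt b.
Proof.
move=> bn y /exp_mono; apply: monoS => g /= gn.
by apply: lt_mdeg_ltmc; rewrite gn.
Qed.

(** The analogue of leading exponents for the lowest term, normalised to coefficient 1. Monomials
    are not presumed independent: an initial exponent of the zero ideal is a relation expressing a
    monomial through greater ones. *)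
Definition initial I : set 'X_{1..d} :=
  [set b | exists2 y, I y & mono_gt b (y - monom b)].

Lemma initialD I J b g : (forall y, I y -> J (monom g * y)) ->
  initial I b -> initial J (g + b)%MM.
Proof.
move=> IJ [y Iy yb]; exists (monom g * y); first exact: IJ.
rewrite monomD -mulrBr; move: yb.
have iC := colon_ideal (monom g) (mono_ideal [set h | ((g + b)%MM < h)%O]).
suff: mono_gt b `<=` colon (mono_gt (g + b)%MM) (monom g).
  by move=> H /H; rewrite /colon /= mulrC.
apply: mono_min => // h /= bh; rewrite /colon /= mulrC -monomD.
by apply: mono_mem; rewrite /= ltmc_add2r.
Qed.

Lemma initialS I J : I `<=` J -> initial I `<=` initial J.
Proof. by move=> IJ b [y /IJ ? ?]; exists y. Qed.

Hypothesis unitm : forall r, ~ m r -> exists s, s * r = 1.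

(** Division by a standard basis: the monomials of an element of [V] in degrees from [n] to [N - 1]
    are cancelled by elements of [U], in increasing order. *)
Lemma initial_sub U V n N : ideal U -> ideal V -> U `<=` V ->
  (forall b, (n <= mdeg b < N)%N -> initial V b -> initial U b) ->
  V `&` ideal_exp m n `<=` ideal_add U (ideal_exp m N).
Proof.
move=> iU iV UV inUV v [Vv /exp_mono nv].
pose bs := [seq w <- enum {: 'X_{1..d < N}} | (n <= mdeg (bmnm w))%N].
pose s := sort <=%O [seq bmnm w | w <- bs].
have memS b : (b \in s) = (n <= mdeg b < N)%N.
  rewrite mem_sort; apply/mapP/idP => [[g]|/andP[nb bN]].
    by rewrite mem_filter => /andP[ng _] ->; rewrite ng bmdeg.
  by exists (BMultinom bN) => //; rewrite mem_filter /= nb mem_enum.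
have sS : sorted <%O s.
  rewrite sort_lt_sorted map_inj_uniq; last exact: val_inj.
  by apply: filter_uniq; apply: enum_uniq.
have upS b : b \in s -> forall g, (b < g)%O -> (mdeg g < N)%N -> g \in s.
  rewrite !memS => /andP[nb _] g bg gN; rewrite memS gN andbT.
  by apply: leq_trans nb _; apply: lemc_mdeg; apply: ltW.
have {}memS b : b \in s -> (n <= mdeg b < N)%N by rewrite memS.
have {nv} : mono [set b | b \in s \/ (N <= mdeg b)%N] v.
  apply: monoS nv => b /= bn; case: (leqP N (mdeg b)) => [|bN]; [by right|left].
  rewrite mem_sort; apply/mapP; exists (BMultinom bN) => //.
  by rewrite mem_filter /= bn leqnn mem_enum.
(* Invariant: [v] lies in [V] and in the ideal of the monomials still listed or of degree at least
   [N]. By [upS] the list holds every greater exponent of degree below [N], so corrections by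
   greater monomials preserve the invariant. *)
elim: (s) sS upS memS v Vv => [|b t IHt] sS upS memS v Vv.
  move=> sv; apply: ideal_addr => //; move: sv; apply: mono_exp.
  by move=> b [].
have bN : (mdeg b < N)%N by have := memS b (mem_head _ _); case/andP.
pose T := [set g | g \in t \/ (N <= mdeg g)%N].
have gtT : mono_gt b `<=` mono T.
  apply: monoS => g /= bg; case: (leqP N (mdeg g)) => [|gN]; [by right|left].
  have := upS b (mem_head _ _) g bg gN; rewrite inE => /orP[/eqP gb|//].
  by rewrite gb ltxx in bg.
have Tgt : mono T `<=` mono_gt b.
  apply: monoS => g /= [gt|Ng].
    by move: sS; rewrite /= (path_sortedE lt_trans) => /andP[/allP/(_ g gt)].
  by apply: lt_mdeg_ltmc; apply: leq_trans Ng.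
have sub : mono [set g | g \in b :: t \/ (N <= mdeg g)%N] `<=`
    ideal_add (principal (monom b)) (mono T).
  apply: mono_min.
    by apply: ideal_add_ideal; [apply: principal_ideal|apply: mono_ideal].
  move=> g /=; rewrite inE => -[/orP[/eqP ->|gt]|Ng].
  - by apply: ideal_addl; [apply: mono_ideal|apply: principal_id].
  - by apply: ideal_addr; [apply: principal_ideal|apply: mono_mem; left].
  - by apply: ideal_addr; [apply: principal_ideal|apply: mono_mem; right].
have IH : forall w, V w -> mono T w -> ideal_add U (ideal_exp m N) w.
  apply: IHt.
  - exact: path_sorted sS.
  - move=> g gt h gh hN; have := upS g; rewrite !inE gt orbT => /(_ isT h gh hN).
    case/orP => [/eqP hb|//]; move: sS; rewrite /= (path_sortedE lt_trans).
    by move=> /andP[/allP/(_ g gt) bg _]; move: (lt_trans bg gh); rewrite hb ltxx.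
  - by move=> g gt; apply: memS; rewrite inE gt orbT.
(* A coefficient [r] in [m] pushes [r * monom b] into greater monomials. A unit makes [b] initial in
   [V], hence in [U], and subtracting [r * u] removes the term. *)
move=> /sub[_ [r ->] Tv]; have [mr|/unitm[s' s'r]] := EM (m r).
  apply: IH => //; rewrite -(subrK (r * monom b) v); apply: idealD => //.
    exact: mono_ideal.
  by apply: gtT; apply: max_monom_gt.
have /inUV : (n <= mdeg b < N)%N by apply: memS; rewrite mem_head.
case=> [|u Uu ub].
  exists (s' * v); first exact: idealMl.
  apply: Tgt; rewrite -[monom b]mul1r -s'r -mulrA -mulrBr.
  by apply: idealMl => //; apply: mono_ideal.
have iUN : ideal (ideal_add U (ideal_exp m N)).
  by apply: ideal_add_ideal => //; apply: ideal_exp_ideal.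
rewrite -(subrK (r * u) v); apply: idealD => //; last first.
  by apply: ideal_addl; [apply: ideal_exp_ideal|apply: idealMl].
apply: IH.
  by apply: idealB => //; apply: idealMl => //; apply: UV.
have iT := mono_ideal T.
have -> : v - r * u = v - r * monom b - r * (u - monom b).
  by rewrite mulrBr opprB addrA subrK.
apply: idealB => //.
by apply: idealMl => //; apply: gtT.
Qed.

End Monomials.

(** * Dickson's lemma *)

Section Dickson.
Local Open Scope nat_scope.

(** Every tail attains its minimum; [phi] runs through positions of minima of successive tails. *)
Lemma nondecreasing_subseq (f : nat -> nat) : exists phi : nat -> nat,
  {homo phi : i j / i < j} /\ {homo f \o phi : i j / i <= j}.
Proof.
have tail n : exists k, n <= k /\ forall j, n <= j -> f k <= f j.
  have exv : exists v, `[< exists k, n <= k /\ f k = v >].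
    by exists (f n); apply/asboolP; exists n.
  case: (ex_minnP exv) => v /asboolP[k [nk <-]] kmin; exists k; split=> // j nj.
  by apply: kmin; apply/asboolP; exists j.
have [t tP] := choice tail.
pose phi := fix phi n := if n is n'.+1 then t (phi n').+1 else t 0.
have phiS n : phi n < phi n.+1 by rewrite /=; case: (tP (phi n).+1).
have fS n : f (phi n) <= f (phi n.+1).
  case: n => [|n]; first by case: (tP 0) => _; apply.
  rewrite [X in f X <= _]/=; case: (tP (phi n).+1) => _; apply.
  by apply: leq_trans (phiS n.+1); rewrite ltnS ltnW.
exists phi; split.
  by apply: homo_ltn => //; exact: ltn_trans.
by apply: homo_leq => //; exact: leq_trans.
Qed.

Lemma nondecreasing_multinom_subseq d (f : nat -> 'X_{1..d}) :
  exists i j, i < j /\ (f i <= f j)%MM.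
Proof.
suff claim k : k <= d -> exists phi : nat -> nat, {homo phi : i j / i < j} /\
    forall l : 'I_d, l < k -> {homo (fun n => f (phi n) l) : i j / i <= j}.
  have [phi [phiS fphi]] := claim d (leqnn d).
  exists (phi 0), (phi 1); split; first exact: phiS.
  by apply/mnm_lepP => l; exact: (fphi l (ltn_ord l) 0 1 isT).
elim: k => [_|k IHk kd]; first by exists id; split=> [i j|l]; rewrite ?ltn0.
have [phi [phiS fphi]] := IHk (ltnW kd).
have [psi [psiS fpsi]] := nondecreasing_subseq (fun n => f (phi n) (Ordinal kd)).
exists (phi \o psi); split=> [i j ij|l]; first by apply/phiS/psiS.
rewrite ltnS leq_eqVlt => /orP[/eqP lk|lk] i j ij.
  have -> : l = Ordinal kd by apply: val_inj.
  exact: fpsi.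
apply: (fphi l lk).
by move: ij; rewrite leq_eqVlt => /orP[/eqP ->//|/psiS/ltnW].
Qed.

(** Otherwise one could keep choosing elements of [S] above none of the earlier choices, yet every
    sequence of exponents has two comparable terms in order. *)
Lemma dickson d (S : set 'X_{1..d}) : exists s : seq 'X_{1..d},
  (forall b, b \in s -> S b) /\
  forall b, S b -> exists2 g, g \in s & (g <= b)%MM.
Proof.
apply: contrapT => noS.
have next (s : seq 'X_{1..d}) : exists b, (forall g, g \in s -> S g) ->
    S b /\ forall g, g \in s -> ~~ (g <= b)%MM.
  apply: contrapT => H; apply: noS; exists s; split.
    move=> b bs; apply: contrapT => Sb; apply: H.
    by exists b => /(_ b bs).
  move=> b Sb; apply: contrapT => nb; apply: H; exists b => _; split=> // g gs.
  by apply/negP => gb; apply: nb; exists g.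
have [F FP] := choice next.
pose s n := iter n (fun t => F t :: t) [::].
have sS n b : b \in s n -> S b.
  elim: n b => [|n IHn] b //=; rewrite inE => /orP[/eqP ->|/IHn//].
  by case: (FP (s n)).
have Fs i j : i < j -> F (s i) \in s j.
  elim: j => // j IHj; rewrite ltnS leq_eqVlt => /orP[/eqP ->|/IHj H] /=.
    by rewrite mem_head.
  by rewrite inE H orbT.
have [i [j [ij]]] := nondecreasing_multinom_subseq (F \o s).
by have [_ /(_ _ (Fs i j ij)) /negbTE ->] := FP (s j) (@sS j).
Qed.

End Dickson.

(** * Krull's intersection theorem and the Artin-Rees lemma *)

Section ArtinRees.
Variables (R : comNzRingType) (m : set R).
Hypotheses (noethR : noetherian R) (locm : local_ring m).
Variables (d : nat) (x : 'I_d -> R).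
Hypothesis genm : m = ispan (range x).
Implicit Types (I J K L P : set R).

Let idealm : ideal m := local_ideal locm.

(** Pigeonhole: a monomial of degree above the sum of the [k i] has some exponent above [k i]. *)
Lemma exp_sub_of_powers L : ideal L -> (forall i, exists k, L (x i ^+ k)) ->
  exists N, ideal_exp m N `<=` L.
Proof.
move=> iL /choice[k Lk]; exists (\sum_i k i).+1.
move=> y /(exp_mono genm); move: y; apply: mono_min => // b /= bk.
have [i kb] : exists i, (k i < b i)%N.
  apply: contrapT => H; have: (mdeg b <= \sum_i k i)%N.
    rewrite mdegE; apply: leq_sum => i _; rewrite leqNgt; apply/negP => kb.
    by apply: H; exists i.
  by rewrite bk ltnn.
rewrite /monom (bigD1 i) //=; apply: idealMr => //.
by rewrite -(subnK (ltnW kb)) exprD; apply: idealMl.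
Qed.

(** Krull's intersection theorem for [R / I]. By Nakayama it suffices that [K] lies in
    [H = I + m K]. An ideal [L] maximal among those containing [H] and meeting [K] inside [H]
    contains a power of [m]; as [K] lies in [I] plus that power, it lies in [L], hence in [H]. *)
Lemma ideal_closed I z : ideal I ->
  (forall n, ideal_add I (ideal_exp m n) z) -> I z.
Proof.
move=> iI Iz; pose K := [set z | forall n, ideal_add I (ideal_exp m n) z].
have iIn n : ideal (ideal_add I (ideal_exp m n)).
  by apply: ideal_add_ideal => //; apply: ideal_exp_ideal.
have iK : ideal K.
  split=> [n|y y' Ky Ky' n|a y Ky n]; first exact: ideal0 (iIn n).
    exact: idealD (iIn n) (Ky n) (Ky' n).
  exact: idealMl (iIn n) (Ky n).
suff: K `<=` I by apply.
pose H := ideal_add I (ideal_mul m K).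
have iH : ideal H by apply: ideal_add_ideal => //; apply: ideal_mul_ideal.
apply: (nakayama noethR locm iI iK).
have [||L [[iL HL LK] _ Lmax]] :=
    @maximal_member _ noethR [set L | [/\ ideal L, H `<=` L & L `&` K `<=` H]] H.
- by move=> L [].
- by split=> // y [].
have [N mNL] : exists N, ideal_exp m N `<=` L.
  apply: exp_sub_of_powers => // i.
  have [k kP] : exists k, forall n, colon L (x i ^+ n) `<=` colon L (x i ^+ k).
    apply: (ascending_chain noethR) => n; first exact: colon_ideal.
    by move=> r; rewrite /colon /= exprSr mulrA => Lr; apply: idealMr.
  exists k; pose L' := ideal_add L (principal (x i ^+ k)).
  have LL' : L `<=` L' by apply: ideal_addl; apply: principal_ideal.
  (* If [w = l + r * x i ^+ k] is in [K], then [x i * w] is in [m K], hence in [L], so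
     [r * x i ^+ k.+1] is in [L]; stability of the colons puts [r * x i ^+ k], and so [w], in
     [L]. *)
  apply: (Lmax L') => //; last by apply: ideal_addr => //; apply: principal_id.
  split; first by apply: ideal_add_ideal => //; apply: principal_ideal.
    by apply: subset_trans LL'.
  move=> w [[l Ll [r wl]] Kw]; apply: LK; split=> //.
  suff: colon L (x i ^+ k) r.
    by rewrite /colon /= -wl => Lwl; rewrite -(subrK l w); apply: idealD.
  apply: (kP k.+1); rewrite /colon /= exprSr mulrA -wl mulrBl.
  apply: idealB => //; last exact: idealMr.
  apply: HL; apply: ideal_addr => //; rewrite mulrC; apply: ideal_mul_mem => //.
  by rewrite genm; apply: ispan_mem; exists i.
move=> y Ky; apply: LK; split=> //; move: (Ky N); apply: ideal_add_min => //.
by apply: subset_trans HL; apply: ideal_addl; apply: ideal_mul_ideal.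
Qed.

(* The constant is the largest degree among a Dickson basis of the initial
   exponents of [I].  *)
Lemma artin_rees I : ideal I -> exists c, forall n,
  I `&` ideal_exp m n `<=` ideal_mul (ideal_exp m (n - c)) I.
Proof.
move=> iI; have [s [sI Is]] := dickson (initial x I).
exists (\max_(b <- s) mdeg b) => n y Iny.
set U := ideal_mul _ _; have iU : ideal U by apply: ideal_mul_ideal.
have UI : U `<=` I by apply: ideal_mul_min => // a b _; apply: idealMl.
apply: ideal_closed => // N.
(* An initial exponent [b] of degree at least [n] is a basis exponent [g] plus [b - g], whose degree
   is at least [n - c]; so [b] is initial in [U]. *)
apply: (initial_sub genm (local_unit noethR locm) iU iI UI _ Iny) => b /andP[nb _].
move=> /Is[g gs gb]; rewrite -(submK gb); apply: initialD (sI _ gs) => z Iz.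
apply: ideal_mul_mem => //; apply: ideal_expW (monom_exp genm _).
rewrite leq_subLR; apply: leq_trans nb _; rewrite -[in X in (mdeg X <= _)%N](submK gb).
by rewrite mdegD addnC leq_add2r; apply: leq_bigmax_seq.
Qed.

(** Artin-Rees for [P + (y)]: if [r * y - u] is in [m ^ n] with [u] in [P], it lies in
    [P + m ^ (n - c) y], so [(r - r') * y] is in [P] for some [r'] in [m ^ (n - c)], and [y] can be
    cancelled modulo the prime [P]. *)
Lemma prime_colon_exp P y : prime_ideal P -> ~ P y -> exists c, forall n,
  colon (ideal_add P (ideal_exp m n)) y `<=` ideal_add P (ideal_exp m (n - c)).
Proof.
move=> [iP P1 PM] Py; pose I := ideal_add P (principal y).
have iI : ideal I by apply: ideal_add_ideal => //; apply: principal_ideal.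
have [c cP] := artin_rees iI; exists c => n r [u Pu mn].
have : ideal_mul (ideal_exp m (n - c)) I (r * y - u).
  apply: cP; split=> //; apply: idealB => //.
    by apply: ideal_addr => //; exists r.
  by apply: ideal_addl => //; apply: principal_ideal.
have iE := ideal_exp_ideal m (n - c).
pose Q := scaled (ideal_exp m (n - c)) y.
have iQ : ideal Q by apply: scaled_ideal.
have IQ : ideal_mul (ideal_exp m (n - c)) I `<=` ideal_add P Q.
  apply: ideal_mul_min => [|a z ma [w Pw [s zw]]]; first exact: ideal_add_ideal.
  exists (a * w); first exact: idealMl.
  by exists (a * s); [exact: idealMr|rewrite -mulrBr zw mulrA].
move=> /IQ[w Pw [r' mr' wr']].
have /PM[Prr|//] : P ((r - r') * y).
  rewrite mulrBl -wr'; have -> : r * y - (r * y - u - w) = u + w.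
    by rewrite -addrA -opprD opprB addrC subrK.
  exact: idealD.
by exists (r - r') => //; rewrite opprB addrC subrK.
Qed.

End ArtinRees.

(** * Counting exponents and comparing growth rates *)

Lemma card_multinom_small_coord d n e :
  (#|[pred b : 'X_{1..d < n} | [exists i : 'I_d, (b i < e)%N]]| <=
   d * (e * n ^ d.-1))%N.
Proof.
rewrite -sum1_card.
have -> : (d * (e * n ^ d.-1) = \sum_(i < d) e * n ^ d.-1)%N.
  by rewrite sum_nat_const card_ord.
apply: (@leq_trans (\sum_(b : 'X_{1..d < n}) \sum_(i < d | (b i < e)%N) 1)%N).
  rewrite [X in (_ <= X)%N](bigID [pred b : 'X_{1..d < n} | [exists i : 'I_d, (b i < e)%N]]) /=.
  apply: leq_trans (leq_addr _ _); apply: leq_sum => b /existsP[i bi].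
  by rewrite (bigD1 i).
rewrite (exchange_big_dep xpredT) //=; apply: leq_sum => i _.
have coord_lt (b : 'X_{1..d < n}) j : (b j < n)%N.
  by apply: leq_ltn_trans (bmdeg b); rewrite mdegE (bigD1 j) //= leq_addr.
pose f (b : 'X_{1..d < n}) : {ffun 'I_d -> 'I_n} := [ffun j => Ordinal (coord_lt b j)].
have f_inj : injective f.
  move=> b g /ffunP bg; apply/eqP; rewrite bmeqP; apply/eqP/mnmP => j.
  by have := congr1 val (bg j); rewrite !ffunE.
(* A box containing the exponents whose [i]-th coordinate is small: at most [e] values at [i], [n]
   values elsewhere. *)
pose F (j : 'I_d) : {pred 'I_n} := [pred l : 'I_n | (j == i) ==> (l < e)%N].
rewrite sum1dep_card -(card_image f_inj).
apply: (@leq_trans #|family F|).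
  apply: subset_leq_card; apply/fintype.subsetP => _ /mapP[b + ->].
  rewrite mem_enum inE => bi; apply/familyP => j.
  by rewrite inE ffunE /=; apply/implyP => /eqP ->.
rewrite card_family foldrE big_map big_enum /= (bigD1 i) //=.
apply: leq_mul.
  rewrite cardE -(size_map val) -[X in (_ <= X)%N](size_iota 0 e).
  apply: uniq_leq_size; first by rewrite (map_inj_uniq val_inj) enum_uniq.
  move=> _ /mapP[l + ->]; rewrite mem_enum inE eqxx mem_iota add0n.
  by move/implyP; apply.
apply: (@leq_trans (\prod_(j < d | j != i) n)%N).
  by apply: leq_prod => j _; rewrite -[X in (_ <= X)%N]card_ord; apply: max_card.
by rewrite prod_nat_const cardC1 card_ord.
Qed.

Lemma expn_ffact_leq d t : (t ^ d <= (d + t) ^_ d)%N.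
Proof.
elim: d => [|d IHd] //; rewrite expnS addSn ffactSS leq_mul //.
by rewrite -addSn leq_addl.
Qed.

(** As functions of [k], the right side has degree [d] and the left side degree [d.-1]. *)
Lemma bin_polynomial_growth d a c :
  exists k, (d * (a * (c * k.+1) ^ d.-1) < 'C(k, d))%N.
Proof.
case: d => [|D]; first by exists 0%N; rewrite mul0n bin0.
apply: contrapT => H.
have expnW u v l : (u <= v -> u ^ l <= v ^ l)%N by case: l => // l; rewrite leq_exp2r.
(* For [k = D.+1 + t] with [t >= D.+2] one has [k.+1 <= 2 * t], whence the factor 2; [M] collects
   all constants, and [t ^ D.+1 <= M * t ^ D] fails for [t > M]. *)
pose M := (D.+1`! * (D.+1 * (a * (c * 2) ^ D)))%N.
pose t := (M + D.+2)%N.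
have tD : (t ^ D.+1 <= M * t ^ D)%N.
  have kle : (D.+1 * (a * (c * (D.+1 + t).+1) ^ D) >= 'C(D.+1 + t, D.+1))%N.
    by rewrite leqNgt; apply/negP => kt; apply: H; exists (D.+1 + t)%N.
  apply: leq_trans (expn_ffact_leq _ _) _; rewrite -bin_ffact mulnC.
  apply: leq_trans (leq_mul (leqnn _) kle) _.
  rewrite /M -!mulnA leq_mul2l leq_mul2l leq_mul2l -expnMn; apply/orP; right.
  apply/orP; right; apply/orP; right.
  rewrite leq_mul // expnW // -mulnA leq_mul //.
  by rewrite -addSn mul2n -addnn leq_add2r leq_addl.
have t0 : (0 < t)%N by rewrite /t addnS.
move: tD; rewrite expnS leq_mul2r expn_eq0 eqn0Ngt t0 /=.
by rewrite leqNgt /t addnS ltnS leq_addr.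
Qed.

(** * Chains of ideals as lower bounds for length *)

Section Chains.
Variable R : comNzRingType.
Implicit Types (I J K P V W : set R).

(** For an ideal [I] this says that [R / I] has length at least [n]; lengths themselves are never
    formed. *)
Fixpoint has_chain n I : Prop :=
  if n is n'.+1 then exists J, [/\ ideal J, I `<` J & has_chain n' J] else True.

Lemma has_chainS n I J : I `<=` J -> has_chain n J -> has_chain n I.
Proof.
case: n => // n IJ [K [iK [JK nKJ] chK]]; exists K; split=> //.
split; first exact: subset_trans JK.
by move=> KI; apply: nKJ; apply: subset_trans KI IJ.
Qed.

Lemma has_chain_leq n k I : (k <= n)%N -> has_chain n I -> has_chain k I.
Proof.
elim: k n I => [|k IHk] [|n] I //; rewrite ltnS => kn [J [iJ IJ chJ]].
by exists J; split=> //; apply: IHk kn chJ.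
Qed.

(** Superadditivity along multiplication by [y] from [R / (I : y)] to [R / I]. The chain above [W]
    is carried to the ideals [y V + I], strictly because [W] contains [I : y]; all of them lie in
    [I'], above which the second chain continues. *)
Lemma has_chain_add n k I I' W y : ideal I -> ideal W ->
  colon I y `<=` W -> I `<=` I' -> ideal I' -> I' y ->
  has_chain n W -> has_chain k I' -> has_chain (n + k) I.
Proof.
move=> iI iW IW II' iI' I'y.
pose yV V := ideal_add (scaled V y) I.
have iyV V : ideal V -> ideal (yV V).
  by move=> iV; apply: ideal_add_ideal => //; apply: scaled_ideal.
move=> chW chI'; suff: has_chain (n + k) (yV W).
  by apply: has_chainS; apply: ideal_addr; apply: scaled_ideal.
elim: n W iW IW chW => [|n IHn] V iV IV.
  move=> _; apply: has_chainS chI'; apply: ideal_add_min => //.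
  by move=> _ [v _ ->]; apply: idealMl.
move=> [V' [iV' [VV' nVV'] chV']]; exists (yV V'); split; first exact: iyV.
  split; first by apply: ideal_addS => // _ [v /VV' ? ->]; exists v.
  move=> V'V; apply: nVV' => v' V'v'.
  have : yV V (v' * y) by apply: V'V; apply: ideal_addl => //; exists v'.
  case=> _ [v Vv ->]; rewrite -mulrBl => /IV Vvv.
  by rewrite -(subrK v v'); apply: idealD.
by apply: IHn => //; apply: subset_trans VV'.
Qed.

End Chains.

(** * Independence of the monomials in a regular system of parameters *)

Section Independence.
Variables (R : comNzRingType) (m : set R).
Hypotheses (noethR : noetherian R) (locm : local_ring m).
Variables (d : nat) (x : 'I_d -> R).
Hypothesis genm : m = ispan (range x).
Implicit Types (I J K P : set R).

Let idealm : ideal m := local_ideal locm.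
Let unitm : forall r, ~ m r -> exists s, s * r = 1 := local_unit noethR locm.

(** Each strict inclusion in the chain gains an initial exponent of degree below [n]: otherwise
    [initial_sub] would make the two ideals equal. *)
Lemma has_chain_le_noninitial n L I : ideal I -> ideal_exp m n `<=` I ->
  has_chain L I ->
  (L <= #|[pred b : 'X_{1..d < n} | ~~ `[< initial x I b >] ]|)%N.
Proof.
elim: L I => // L IHL I iI mI [J [iJ [IJ nJI] chJ]].
apply: leq_ltn_trans (IHL J iJ (subset_trans mI IJ) chJ) _.
apply: proper_card; apply/properP; split.
  apply/fintype.subsetP => b; rewrite !inE; apply: contra => /asboolP Ib.
  by apply/asboolP; apply: initialS Ib.
apply: contrapT => H; apply: nJI => y Jy.
have : ideal_add I (ideal_exp m n) y.
  apply: (initial_sub (n := 0) genm unitm iI iJ IJ) => // b /andP[_ bn] Jb.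
  apply: contrapT => Ib; apply: H; exists (BMultinom bn); rewrite !inE.
    by apply/asboolPn.
  by rewrite negbK; apply/asboolP.
exact: ideal_add_min.
Qed.

Section PrimeChain.
Variable P : nat -> set R.
Hypothesis primeP : forall i, (i <= d)%N -> prime_ideal (P i).
Hypothesis strictP : forall i, (i < d)%N -> P i `<` P i.+1.

Let idealP i : (i <= d)%N -> ideal (P i). Proof. by move=> /primeP[]. Qed.

(* For [y] in [P i.+1] but not in [P i], a chain above [P i + m ^ n] is glued
   from a chain above [P i.+1 + m ^ n] and [y] times a chain above
   [P i + m ^ (n - c)]: the growth of the lengths follows Pascal's triangle.  *)
Lemma has_chain_bin : exists c, forall j, (j <= d)%N -> forall k,
  has_chain 'C(k, j) (ideal_add (P (d - j)) (ideal_exp m (c * k.+1))).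
Proof.
have ex_c (i : 'I_d) : exists yc : R * nat, P i.+1 yc.1 /\ forall n,
    colon (ideal_add (P i) (ideal_exp m n)) yc.1 `<=`
    ideal_add (P i) (ideal_exp m (n - yc.2)).
  have [_ PP] := strictP (ltn_ord i).
  have [y Py Piy] : exists2 y, P i.+1 y & ~ P i y.
    apply: contrapT => H; apply: PP => y Py; apply: contrapT => Piy.
    by apply: H; exists y.
  have [c cP] := prime_colon_exp noethR locm genm (primeP (ltnW (ltn_ord i))) Piy.
  by exists (y, c).
have [yc ycP] := choice ex_c.
(* One constant for all links of the prime chain; the successor keeps the exponent [c * k.+1]
   positive, so that the ideal at [j = 0] is proper. *)
pose c := (\max_i (yc i).2).+1; exists c; elim=> [|j IHj] jd k.
  rewrite bin0 subn0; exists [set: R]; split=> //.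
  split=> // /(_ 1 I) Pd1; apply: (local_proper locm); move: Pd1.
  suff: ideal_add (P d) (ideal_exp m (c * k.+1)) `<=` m by apply.
  apply: ideal_add_min => //.
    by have [iP P1 _] := primeP (leqnn d); apply: (proper_sub_max noethR locm).
  rewrite -[X in _ `<=` X](ideal_exp1E idealm); apply: ideal_expW.
  by rewrite muln_gt0.
elim: k => [|k IHk]; first by rewrite bin0n.
have id : (d - j.+1 < d)%N by rewrite ltn_subrL /= (leq_ltn_trans _ jd).
have iS : (d - j.+1).+1 = (d - j)%N by rewrite subnSK.
have [Py Pcolon] := ycP (Ordinal id); rewrite /= iS in Py Pcolon.
have [PP _] := strictP id; rewrite iS in PP.
have cle : ((yc (Ordinal id)).2 <= c)%N.
  by apply/ltnW; rewrite ltnS; apply: (leq_bigmax (F := fun i => (yc i).2)).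
have iE n : ideal (ideal_exp m n) by apply: ideal_exp_ideal.
have iPS : ideal (P (d - j)) by apply: idealP; apply: leq_subr.
have iP : ideal (P (d - j.+1)) by apply: idealP; apply: leq_subr.
rewrite binS; apply: (has_chain_add (I' := ideal_add (P (d - j)) (ideal_exp m (c * k.+2)))
  (W := ideal_add (P (d - j.+1)) (ideal_exp m (c * k.+1))) (y := (yc (Ordinal id)).1)) => //.
- exact: ideal_add_ideal.
- exact: ideal_add_ideal.
- apply: subset_trans (Pcolon _) _; apply: ideal_addS => //.
  apply: ideal_expW; rewrite [(c * k.+2)%N]mulnS leq_subRL.
    by rewrite leq_add2r.
  exact: leq_trans (leq_addr _ _).
- exact: ideal_addS.
- exact: ideal_add_ideal.
- exact: ideal_addl.
- apply: has_chain_leq (IHj (ltnW jd) k.+1).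
  by case: (j) => [|j']; rewrite ?bin0 // binS leq_addr.
Qed.

(** Otherwise every exponent above [b] is initial in every ideal, and a non-initial exponent has a
    coordinate below [mdeg b]. There are too few of those to bound the binomial chains of
    [has_chain_bin]. *)
Lemma no_initial0 b : ~ initial x [set 0] b.
Proof.
move=> b0; have [c chP] := has_chain_bin.
have [k] := bin_polynomial_growth d (mdeg b) c; rewrite ltnNge => /negP; apply.
have iP := idealP (leq0n d).
have iE := ideal_exp_ideal m (c * k.+1).
have iI : ideal (ideal_add (P 0) (ideal_exp m (c * k.+1))).
  by apply: ideal_add_ideal.
have := chP d (leqnn d) k; rewrite subnn => chk.
apply: leq_trans (has_chain_le_noninitial iI (ideal_addr iP) chk) _.
apply: leq_trans (card_multinom_small_coord _ _ _).
apply: subset_leq_card; apply/fintype.subsetP => g; rewrite !inE.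
move=> /asboolP Ig; apply/existsP; apply: contrapT => gb; apply: Ig.
have bg : (b <= g)%MM.
  apply/mnm_lepP => i; apply: (@leq_trans (mdeg b)).
    by rewrite mdegE (bigD1 i) //= leq_addr.
  by rewrite leqNgt; apply/negP => gi; apply: gb; exists i.
rewrite -(submK bg); apply: initialD b0 => _ ->; rewrite mulr0.
exact: ideal0.
Qed.

End PrimeChain.

(** Take the least exponent whose coefficient is a unit. The other terms have a greater exponent or
    a coefficient in [m], so this exponent would be initial in the zero ideal. *)
Lemma monomials_independent (J : finType) (Q : pred J) (g : J -> 'X_{1..d})
    (y : J -> R) n :
  prime_chain R d -> {in Q &, injective g} ->
  (forall j, Q j -> mdeg (g j) = n) ->
  ideal_exp m n.+1 (\sum_(j | Q j) y j * monom x (g j)) ->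
  forall j, Q j -> m (y j).
Proof.
move=> [P [primeP strictP]] g_inj gn my j0 Qj0; apply: contrapT => myj0.
pose B := [pred j | Q j && ~~ `[< m (y j) >] ].
have Bj0 : B j0 by rewrite /= Qj0; apply/asboolPn.
case: (@Order.TotalTheory.arg_minP _ _ _ j0 B g Bj0) => j /andP[Qj /asboolPn myj] jmin.
have igt := mono_ideal x [set h | (g j < h)%O].
have [s sy] := unitm myj.
apply: (no_initial0 primeP strictP (b := g j)).
exists 0 => //; rewrite sub0r; apply: idealN => //.
rewrite -[monom _ _]mul1r -sy -mulrA; apply: idealMl => //.
have := exp_mono_gt (n := n.+1) genm (b := g j); rewrite gn // => /(_ (leqnn _) _ my).
rewrite (bigD1 j) //= => /(idealB igt) H.
rewrite -[X in _ X](addrK (\sum_(i | Q i && (i != j)) y i * monom x (g i))).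
apply: H; apply: ideal_sum => // i /andP[Qi ij].
have [myi|myi] := EM (m (y i)).
  have := exp_mono_gt (n := n.+1) genm (b := g j); rewrite gn //; apply=> //.
  rewrite -add1n; apply: ideal_expD; first exact: ideal_exp1.
  by rewrite -(gn i Qi); apply: monom_exp.
apply: idealMl => //; apply: mono_mem; rewrite /= lt_def.
rewrite (inj_in_eq g_inj) ?ij //=; apply: jmin.
by rewrite /= Qi; apply/asboolPn.
Qed.

End Independence.

(** * Expansions with [p]-th power coefficients *)

Lemma big_uniq_support (V : nmodType) (T : eqType) (s t : seq T) (F : T -> V) :
  uniq s -> uniq t -> {subset s <= t} -> (forall i, i \notin s -> F i = 0) ->
  \sum_(i <- t) F i = \sum_(i <- s) F i.
Proof.
move=> us ut st Fs; rewrite (bigID (mem s)) /= [X in _ + X]big1 ?addr0 //.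
rewrite -big_filter; apply: perm_big; apply: uniq_perm => //.
  exact: filter_uniq.
by move=> i; rewrite mem_filter; case: (boolP (i \in s)) => //= /st ->.
Qed.

Section FrobeniusExpansions.
Variables (R : comNzRingType) (p : nat) (m : set R).
Hypotheses (charR : p \in [pchar R]) (noethR : noetherian R).
Hypotheses (locm : local_ring m) (cplR : adically_complete m).
Variables (d : nat) (x : 'I_d -> R).
Hypotheses (genm : m = ispan (range x)) (chainR : prime_chain R d).
Implicit Types (I J K : set R).

Let idealm : ideal m := local_ideal locm.
Let unitm : forall r, ~ m r -> exists s, s * r = 1 := local_unit noethR locm.
Let iE n : ideal (ideal_exp m n) := ideal_exp_ideal m n.

Let p_gt0 : (0 < p)%N.
Proof. by rewrite prime_gt0 // (pcharf_prime charR). Qed.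

Let exp0p : 0 ^+ p = 0 :> R.
Proof. by rewrite expr0n eqn0Ngt p_gt0. Qed.

Let expp_sum (T : Type) (s : seq T) (P : pred T) (F : T -> R) :
  (\sum_(i <- s | P i) F i) ^+ p = \sum_(i <- s | P i) F i ^+ p.
Proof. exact: (rmorph_sum (pFrobenius_aut charR)). Qed.

Let exppD a b : (a + b) ^+ p = a ^+ p + b ^+ p :> R.
Proof. exact: (rmorphD (pFrobenius_aut charR)). Qed.

Let exppN a : (- a) ^+ p = - a ^+ p :> R.
Proof. exact: (rmorphN (pFrobenius_aut charR)). Qed.

Let exppB a b : (a - b) ^+ p = a ^+ p - b ^+ p :> R.
Proof. by rewrite exppD exppN. Qed.

(* The residues modulo [m] are linearly independent over the subfield of
   [p]-th powers of the residue field.  *)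
Definition p_independent (B : set R) : Prop :=
  forall (s : seq R) (c : R -> R), uniq s -> (forall u, u \in s -> B u) ->
    m (\sum_(u <- s) c u ^+ p * u) -> forall u, u \in s -> m (c u).

(** A maximal independent set, from Zorn's lemma, spans: an element without expansion could be
    adjoined. *)
Lemma exists_p_basis : exists B, p_independent B /\ forall f,
  exists (s : seq R) (c : R -> R), [/\ uniq s, forall u, u \in s -> B u &
    m (f - \sum_(u <- s) c u ^+ p * u)].
Proof.
have [|B [indB maxB]] := @Zorn_bigcup R p_independent.
  move=> C Cind Ctot s c us sC.
  (* Finitely many elements of the union of a chain lie in a single member; the empty list is
     separate since the chain may be empty. *)
  have [->//|[X CX sX]] : s = [::] \/ exists2 X, C X & forall u, u \in s -> X u.
    elim: s {us} sC => [|u s IHs] sC; [by left|right].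
    have [Y CY Yu] := sC u (mem_head _ _).
    have [|->|[X CX sX]] := IHs.
    - by move=> v vs; apply: sC; rewrite inE vs orbT.
    - by exists Y => // v; rewrite inE => /eqP ->.
    have [XY|YX] := Ctot X Y CX CY.
      by exists Y => // v; rewrite inE => /orP[/eqP ->|/sX/XY].
    by exists X => // v; rewrite inE => /orP[/eqP ->|/sX//]; apply: YX.
  by apply: Cind CX s c us sX.
exists B; split=> // f; have [Bf|Bf] := EM (B f).
  exists [:: f], (fun=> 1); split=> //; first by move=> u; rewrite inE => /eqP ->.
  by rewrite big_seq1 expr1n mul1r subrr; apply: ideal0.
pose B' := [set u | B u \/ u = f].
have : ~ p_independent B'.
  apply: maxB; split; first by move=> u Bu; left.
  by move=> /(_ f) BB'; apply/Bf/BB'; right.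
apply: contra_notP => noexp s c us sB' ms.
case: (boolP (f \in s)) => fs; last first.
  apply: indB => // u us'; case: (sB' u us') => // uf.
  by rewrite -uf us' in fs.
rewrite (perm_big _ (perm_to_rem fs)) big_cons in ms.
have uf : uniq (rem f s) by apply: rem_uniq.
have fB u : u \in rem f s -> B u.
  by rewrite mem_rem_uniq // inE => /andP[/eqP uf' /sB'[]].
have [mcf|/unitm[t tcf]] := EM (m (c f)).
  have mrem : m (\sum_(u <- rem f s) c u ^+ p * u).
    rewrite -[X in m X](addKr (c f ^+ p * f)) addrC; apply: idealB => //.
    by apply: idealMr => //; rewrite -(prednK p_gt0) exprS; apply: idealMr.
  move=> u us'; have [->//|/eqP uf'] := EM (u = f).
  by apply: (indB _ _ uf fB mrem); rewrite mem_rem_uniq // inE uf'.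
(* The coefficient of [f] is a unit with inverse [t]: multiplying the relation by [t ^+ p] solves it
   for [f]. *)
exfalso; apply: noexp; exists (rem f s), (fun u => - (t * c u)); split=> //.
have := idealMl (t ^+ p) idealm ms; congr m.
rewrite mulrDr mulrA -exprMn tcf expr1n mul1r mulr_sumr -sumrN; congr (_ + _).
by apply: eq_bigr => u _; rewrite exppN mulNr opprK exprMn mulrA.
Qed.

Variable B : set R.
Hypothesis indB : p_independent B.
Hypothesis spanB : forall f, exists (s : seq R) (c : R -> R),
  [/\ uniq s, forall u, u \in s -> B u & m (f - \sum_(u <- s) c u ^+ p * u)].

Local Notation index := (R * 'X_{1..d})%type.
Implicit Types (l : index) (h : index -> R).

Definition frob_basis l : R := l.1 * monom x l.2.

Definition frob_index : set index := [set l : index | B l.1 /\ forall i, (l.2 i < p)%N].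

(** Only finite expansions are formed; the coefficients of an infinite one arise later as limits. *)
Definition expansion h (f : R) : Prop :=
  exists s : seq index, [/\ uniq s, forall l, l \in s -> frob_index l,
    forall l, l \notin s -> h l = 0 & f = \sum_(l <- s) h l ^+ p * frob_basis l].

(** Covers sums ([r = 1]), differences ([r = -1]) and scaling by [p]-th powers ([f' = 0]) at
    once. *)
Lemma expansion_lin r h h' f f' : expansion h f -> expansion h' f' ->
  expansion (fun l => r * h l + h' l) (r ^+ p * f + f').
Proof.
move=> [s [us sB hs fE]] [s' [us' sB' hs' fE']].
have ut : uniq (undup (s ++ s')) by apply: undup_uniq.
exists (undup (s ++ s')); split=> //.
- by move=> l; rewrite mem_undup mem_cat => /orP[/sB|/sB'].
- move=> l; rewrite mem_undup mem_cat negb_or => /andP[/hs -> /hs' ->].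
  by rewrite mulr0 addr0.
have -> : f = \sum_(l <- undup (s ++ s')) h l ^+ p * frob_basis l.
  rewrite fE; apply/esym/big_uniq_support => // l.
    by rewrite mem_undup mem_cat => ->.
  by move=> /hs ->; rewrite exp0p mul0r.
have -> : f' = \sum_(l <- undup (s ++ s')) h' l ^+ p * frob_basis l.
  rewrite fE'; apply/esym/big_uniq_support => // l.
    by rewrite mem_undup mem_cat orbC => ->.
  by move=> /hs' ->; rewrite exp0p mul0r.
rewrite mulr_sumr -big_split; apply: eq_bigr => l _.
by rewrite /= exppD exprMn mulrDl mulrA.
Qed.

Lemma expansion0 : expansion (fun=> 0) 0.
Proof. by exists [::]; rewrite big_nil. Qed.

Lemma expansion_monom r u b : B u ->
  exists h, expansion h (r ^+ p * (u * monom x b)).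
Proof.
move=> Bu; pose a := [multinom (b i %% p)%N | i < d]%MM.
pose b' := [multinom (b i %/ p)%N | i < d]%MM.
have bE : b = (b' *+ p + a)%MM.
  by apply/mnmP => i; rewrite mnmDE mulmnE !mnmE -divn_eq.
have monomMn n : monom x (b' *+ n)%MM = monom x b' ^+ n.
  by rewrite /monom -prodrXl; apply: eq_bigr => i _; rewrite mulmnE exprM.
exists (fun l => if l == (u, a) then r * monom x b' else 0), [:: (u, a)]; split=> //.
- move=> l; rewrite inE => /eqP ->; split=> // i; by rewrite mnmE ltn_mod.
- by move=> l; rewrite inE => /negbTE ->.
rewrite big_seq1 eqxx bE monomD monomMn exprMn /frob_basis /=.
by rewrite -!mulrA [u * _]mulrCA.
Qed.

(** Successive approximation: the error in degree [n] is a combination of monomials, and expanding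
    its coefficients modulo [m] by [spanB] leaves an error in degree [n + 1]. *)
Lemma expansion_approx n f : exists h g, expansion h g /\ ideal_exp m n (f - g).
Proof.
pose X := [set g | exists h, expansion h g].
have XD g g' : X g -> X g' -> X (g + g').
  move=> [h hg] [h' hg']; exists (fun l => 1 * h l + h' l).
  by have := expansion_lin 1 hg hg'; rewrite expr1n mul1r.
have X0 : X 0 by exists (fun=> 0); apply: expansion0.
have X_monom c b : exists2 g, X g & ideal_exp m (mdeg b).+1 (c * monom x b - g).
  have [s [c' [us sB mc]]] := spanB c.
  exists (\sum_(u <- s) c' u ^+ p * (u * monom x b)).
    rewrite big_seq; elim/big_ind: _ => // u /sB Bu.
    exact: expansion_monom.
  have -> : \sum_(u <- s) c' u ^+ p * (u * monom x b) =
      (\sum_(u <- s) c' u ^+ p * u) * monom x b.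
    by rewrite mulr_suml; apply: eq_bigr => u _; rewrite mulrA.
  rewrite -mulrBl -add1n; apply: ideal_expD; first exact: ideal_exp1.
  exact: monom_exp genm _.
suff [g [h hg] fg] : exists2 g, X g & ideal_exp m n (f - g) by exists h, g.
elim: n => [|n [g Xg fg]]; first by exists 0.
have [c cE] := exp_homogeneous genm (ltnSn n) fg.
have [g' Xg' mg'] : exists2 g', X g' & ideal_exp m n.+1 (f - g - g').
  rewrite cE; elim/big_ind: _ => [|y y' [w Xw yw] [w' Xw' yw']|b /eqP bn].
  - by exists 0 => //; rewrite subrr; apply: ideal0.
  - by exists (w + w'); [exact: XD|rewrite opprD addrACA; apply: idealD].
  - by have := X_monom (c b) b; rewrite bn.
by exists (g + g'); [exact: XD|rewrite opprD addrA].
Qed.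

(** For positive [n] the bound reads [p * (n - 1) + mdeg l.2 < T]: a coefficient of order only
    [n - 1] would give a term of degree below [T]. By induction on [T], the terms of lowest degree
    form a homogeneous relation, killed by independence of the monomials and then of [B]. *)
Lemma expansion_unique T h f : expansion h f -> ideal_exp m T f ->
  forall l n, (p * n + mdeg l.2 < T + p)%N -> ideal_exp m n (h l).
Proof.
move=> [s [us sB hs ->]].
elim: T => [|T IHT] mT l n.
  by case: n => // n; rewrite add0n mulnS -addnA ltnNge leq_addr.
have {}IHT := IHT (ideal_expW (leqnSn T) mT).
rewrite addSn ltnS leq_eqVlt => /orP[/eqP|]; last exact: IHT.
(* The only new case is [p * n + mdeg l.2 = T], where [h l] must be shown to lie in [m ^ n.+1]. *)
case: n => // n; rewrite mulnS -addnA [in RHS]addnC => /addnI lT.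
case: (boolP (l \in s)) => [ls|/hs ->]; last exact: ideal0.
(* The good indices are those whose term can have degree exactly [T]; its coefficient then has order
   [nu k]. For any other index rounding up gains a degree, as [bad] records. *)
pose good (k : index) := (mdeg k.2 <= T)%N && (p %| T - mdeg k.2)%N.
pose nu (k : index) := ((T - mdeg k.2) %/ p)%N.
have nuE k : good k -> (p * nu k + mdeg k.2)%N = T.
  by move=> /andP[kT pk]; rewrite mulnC divnK // subnK.
have goodI (k : index) v : (p * v + mdeg k.2)%N = T -> good k.
  by move=> vT; rewrite /good -vT leq_addl addnK dvdn_mulr.
have nuT k : (nu k < T.+1)%N by rewrite ltnS (leq_trans (leq_div _ _)) ?leq_subr.
have ex_c (k : index) : exists c : 'X_{1..d} -> R, good k ->
    h k = \sum_(b : 'X_{1..d < T.+1} | mdeg b == nu k) c b * monom x b.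
  have [gk|] := boolP (good k); last by exists (fun=> 0).
  have [|c cE] := exp_homogeneous genm (nuT k) (IHT k (nu k) _); last by exists c.
  by rewrite nuE // -[X in (X < _)%N]addn0 ltn_add2l.
have [c cE] := choice ex_c.
have bad k : ~~ good k -> ideal_exp m T.+1 (h k ^+ p * frob_basis k).
  move=> gk; have [kT|kT] := ltnP T (mdeg k.2).
    do 2!apply: idealMl => //; apply: ideal_expW kT _ _; exact: monom_exp.
  have nup : (p * nu k < T - mdeg k.2)%N.
    rewrite mulnC /nu ltn_neqAle leq_trunc_div andbT.
    by move: gk; rewrite /good kT /= dvdn_eq.
  have hk : ideal_exp m (nu k).+1 (h k).
    apply: IHT; rewrite mulnS addnC addnCA [(T + p)%N]addnC ltn_add2l.
    by rewrite -ltn_subRL.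
  apply: (@ideal_expW _ _ _ ((nu k).+1 * p + mdeg k.2)%N).
    by rewrite -[X in (X < _)%N](subnK kT) ltn_add2r; apply: ltn_ceil.
  apply: ideal_expD; first exact: ideal_expX.
  by apply: idealMl => //; apply: monom_exp.
(* Expanding the good [h k] into monomials yields terms [c ^+ p * u] times the monomial of exponent
   [p b + a]. The pairs [(a, b)] are distinct for distinct monomials, by division with remainder;
   [y] sums over the [u] sharing a monomial. *)
pose J := ('X_{1..d < T.+1} * 'X_{1..d < T.+1})%type.
pose Q (j : J) := [forall i : 'I_d, (j.1 i < p)%N] && (p * mdeg j.2 + mdeg j.1 == T)%N.
pose g (j : J) : 'X_{1..d} := (j.2 *+ p + j.1)%MM.
pose y (j : J) := \sum_(k <- s | k.2 == j.1) c k j.2 ^+ p * k.1.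
have gT j : Q j -> mdeg (g j) = T.
  by move=> /andP[_ /eqP <-]; rewrite mdegD mdegMn mulnC.
have g_inj : {in Q &, injective g}.
  move=> [a b] [a' b'] /andP[/forallP /= ap _] /andP[/forallP /= ap' _] gg.
  have ga i : (b i * p + a i = b' i * p + a' i)%N.
    by have /mnmP/(_ i) := gg; rewrite /g !mnmDE !mulmnE.
  congr (_, _); apply/val_inj/mnmP => i /=.
    have := congr1 (modn^~ p) (ga i).
    by rewrite !modnMDl !modn_small.
  have := congr1 (divn^~ p) (ga i).
  by rewrite !divnMDl // !divn_small // !addn0.
have hkE k : k \in s -> good k -> h k ^+ p * frob_basis k =
    \sum_(j : J | (k.2 == j.1) && Q j) c k j.2 ^+ p * k.1 * monom x (g j).
  move=> ks gk.
  have kT : (mdeg k.2 < T.+1)%N by case/andP: gk.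
  transitivity (\sum_(a : 'X_{1..d < T.+1} | k.2 == a)
      \sum_(b : 'X_{1..d < T.+1} | Q (a, b)) c k b ^+ p * k.1 * monom x (g (a, b))).
    rewrite (big_pred1 (BMultinom kT)); last by move=> a /=; rewrite [RHS]bmeqP eq_sym.
    rewrite (cE k gk) expp_sum mulr_suml; apply: eq_big => [b|b _].
      rewrite /Q /=; have -> : [forall i : 'I_d, (k.2 i < p)%N].
        by apply/forallP => i; case: (sB k ks).
      rewrite -[in X in _ = (_ == X)](nuE k gk) eqn_add2r.
      by rewrite eqn_pmul2l.
    rewrite exprMn /g /frob_basis /= monomD -!mulrA; congr (_ * _).
    rewrite mulrCA; congr (_ * (_ * _)).
    by rewrite /monom -prodrXl; apply: eq_bigr => i _; rewrite mulmnE exprM.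
  by rewrite (pair_big_dep _ (fun a b => Q (a, b))); apply: eq_bigl => -[a b].
have my : ideal_exp m T.+1 (\sum_(j | Q j) y j * monom x (g j)).
  have -> : \sum_(j | Q j) y j * monom x (g j) =
      \sum_(k <- s | good k) h k ^+ p * frob_basis k.
    transitivity (\sum_(k <- s | good k) \sum_(j : J | (k.2 == j.1) && Q j)
        c k j.2 ^+ p * k.1 * monom x (g j)); last first.
      rewrite big_seq_cond [RHS]big_seq_cond.
      by apply: eq_bigr => k /andP[ks gk]; rewrite -hkE.
    under eq_bigr => j _ do rewrite /y mulr_suml.
    rewrite (exchange_big_dep good) /=; last first.
      move=> [a b] k /andP[_ /eqP Qab] /eqP /= ka.
      by apply: goodI (mdeg b) _; rewrite ka.
    by apply: eq_bigr => k _; apply: eq_bigl => j; rewrite andbC.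
  rewrite -[X in _ X](addrK (\sum_(k <- s | ~~ good k) h k ^+ p * frob_basis k)).
  apply: idealB => //; last by apply: ideal_sum.
  by move: mT; rewrite (bigID good).
have ml (b : 'X_{1..d < T.+1}) : mdeg b == n -> m (c l b).
  move=> /eqP bn.
  have lT' : (mdeg l.2 < T.+1)%N by rewrite ltnS -lT leq_addl.
  have Qj : Q (BMultinom lT', b).
    rewrite /Q /= bn lT eqxx andbT; apply/forallP => i.
    by case: (sB l ls).
  (* This puts [y] at the pair in [m]; as a combination of distinct elements of [B] with [p]-th
     power coefficients, it has all its [c] in [m]. *)
  have := monomials_independent noethR locm genm chainR g_inj gT my Qj.
  rewrite /y /= -big_filter.
  pose t := [seq k <- s | k.2 == l.2].
  have -> : \sum_(k <- t) c k b ^+ p * k.1 =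
      \sum_(u <- [seq k.1 | k <- t]) c (u, l.2) b ^+ p * u.
    rewrite big_map; apply: eq_big_seq => -[u a].
    by rewrite mem_filter => /andP[/eqP /= <-].
  move/indB => H; have := H _ _ l.1; rewrite -surjective_pairing; apply.
  - rewrite map_inj_in_uniq ?filter_uniq // => -[u a] [u' a'].
    by rewrite !mem_filter => /andP[/eqP /= -> _] /andP[/eqP /= -> _] ->.
  - by move=> u /mapP[k]; rewrite mem_filter => /andP[_ /sB[]] + _ ->.
  - by apply/mapP; exists l => //; rewrite mem_filter eqxx.
have gl : good l := goodI _ _ lT.
have nul : nu l = n.
  by apply/eqP; rewrite -(eqn_pmul2l p_gt0) -(eqn_add2r (mdeg l.2)) nuE // lT.
rewrite (cE l gl) nul; apply: ideal_sum => // b bn.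
rewrite -add1n; apply: ideal_expD; first exact/ideal_exp1/ml.
by rewrite -(eqP bn); apply: monom_exp.
Qed.

Lemma mdeg_frob_index l : frob_index l -> (mdeg l.2 <= d * p)%N.
Proof.
move=> [_ lp]; rewrite mdegE -[X in (X * _)%N]card_ord -sum_nat_const.
by apply: leq_sum => i _; apply/ltnW/lp.
Qed.

(** The summand [d * p] absorbs the degree of the basis monomial, so this precision on [f] fixes the
    coefficients modulo [m ^ n]. *)
Lemma expansion_close l n f h g h' g' : expansion h g -> expansion h' g' ->
  ideal_exp m (p * n + d * p) (f - g) -> ideal_exp m (p * n + d * p) (f - g') ->
  ideal_exp m n (h l - h' l).
Proof.
move=> hg hg' fg fg'; have := expansion_lin (-1) hg' hg.
rewrite exppN expr1n mulN1r => hgg'.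
have gg' : ideal_exp m (p * n + d * p) (- g' + g).
  by have := idealB (iE _) fg' fg; rewrite opprB addrC addrA subrK addrC.
have [lB|lB] := EM (frob_index l).
  have := expansion_unique hgg' gg' (l := l) (n := n); rewrite mulN1r addrC; apply.
  rewrite -addnA ltn_add2l; apply: leq_ltn_trans (mdeg_frob_index lB) _.
  by rewrite -[X in (X < _)%N]addn0 ltn_add2l.
have h0 k e : expansion k e -> k l = 0.
  by move=> [s [_ sB ks _]]; apply: ks; apply/negP => /sB.
by rewrite (h0 _ _ hg) (h0 _ _ hg') subrr; apply: ideal0.
Qed.

(** The limit, by completeness, of the coefficients of ever better approximations of [f]. *)
Lemma exists_coefficient l f : exists y, forall n h g, expansion h g ->
  ideal_exp m (p * n + d * p) (f - g) -> ideal_exp m n (y - h l).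
Proof.
have [hg hgP] := choice (fun n => expansion_approx (p * n + d * p) f).
have {hgP} [g gP] := choice hgP.
have [|y yP] := cplR.2 (fun n => hg n l).
  move=> n /=; have [e1 m1] := gP n.+1; have [e2 m2] := gP n.
  apply: (expansion_close l (f := f) e1 e2 _ m2).
  by apply: ideal_expW m1; rewrite leq_add2r leq_mul2l leqnSn orbT.
exists y => n h g' hg' mg'; have [e m1] := gP n.
rewrite -(subrK (hg n l) y) -addrA; apply: idealD => //.
exact: (expansion_close l (f := f) e hg' m1 mg').
Qed.

Definition cartier e (phi : R -> R) : Prop :=
  {morph phi : r s / r + s} /\ forall s r, phi (s ^+ (p ^ e) * r) = s * phi r.

Definition frob_power e I : set R := ispan [set y ^+ (p ^ e) | y in I].

(** The coefficient functions are Cartier maps. Modulo [m ^ n], [f] is a finite combination of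
    [p]-th powers of its coefficients, which lie in [I]; closedness of [I^[p]] concludes. *)
Lemma cartier_detects1 I f : ideal I ->
  (forall phi, cartier 1 phi -> I (phi f)) -> frob_power 1 I f.
Proof.
move=> iI If.
have [phi phiP] := choice (fun lf : index * R => exists_coefficient lf.1 lf.2).
(* Coefficients are determined by their approximations, since the powers of [m] intersect in 0;
   additivity and scaling reduce to finite expansions. *)
have uniq_coef l f' y : (forall n, exists h g, [/\ expansion h g,
    ideal_exp m (p * n + d * p) (f' - g) & ideal_exp m n (y - h l)]) ->
    phi (l, f') = y.
  move=> yP; apply/eqP; rewrite -subr_eq0; apply/eqP/cplR.1 => n.
  have [h [g [hg fg yh]]] := yP n.
  have := idealB (iE n) (phiP (l, f') n h g hg fg) yh.
  by rewrite opprB addrA subrK.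
have phi_cartier l : cartier 1 (fun f => phi (l, f)).
  split=> [a b|s r].
    apply: uniq_coef => n.
    have [h [g [hg ag]]] := expansion_approx (p * n + d * p) a.
    have [h' [g' [hg' bg']]] := expansion_approx (p * n + d * p) b.
    exists (fun l => 1 * h l + h' l), (1 ^+ p * g + g').
    split; first exact: expansion_lin.
      by rewrite expr1n mul1r opprD addrACA; apply: idealD.
    rewrite mul1r opprD addrACA; apply: idealD => //.
      exact: (phiP (l, a) n h g).
    exact: (phiP (l, b) n h' g').
  rewrite expn1; apply: uniq_coef => n.
  have [h [g [hg ag]]] := expansion_approx (p * n + d * p) r.
  exists (fun l => s * h l + 0), (s ^+ p * g + 0).
  split; first exact: expansion_lin hg expansion0.
    by rewrite addr0 -mulrBr; apply: idealMl.
  rewrite addr0 -mulrBr; apply: idealMl => //.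
  exact: (phiP (l, r) n h g).
have iIp : ideal (frob_power 1 I) by apply: ispan_ideal.
apply: (ideal_closed noethR locm genm iIp) => n.
have [h [g [hg fg]]] := expansion_approx (p * n + d * p) f.
have iA : ideal (ideal_add (frob_power 1 I) (ideal_exp m n)).
  exact: ideal_add_ideal.
rewrite -(subrK g f); apply: idealD => //.
  apply: ideal_addr => //.
  apply: ideal_expW fg.
  by apply: leq_trans (leq_addr _ _); apply: leq_pmull.
have [s [us sB hs ->]] := hg; apply: ideal_sum => // l _; apply: idealMr => //.
have {}hE : h l = phi (l, f) - (phi (l, f) - h l) by rewrite opprB addrC subrK.
rewrite hE exppB; apply: idealB => //.
  apply: ideal_addl => //; apply: ispan_mem.
  by exists (phi (l, f)); [exact: (If (fun f => phi (l, f)))|rewrite expn1].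
apply: ideal_addr => //; have := phiP (l, f) n h g hg fg => /= /ideal_expX.
move=> /(_ p); apply: ideal_expW; exact: leq_pmulr.
Qed.

End FrobeniusExpansions.

(** * The cyclic module [R / J] *)

Section QuotientModule.
Variable R : comNzRingType.

(** Carrying the proof as an argument lets the closure instance be inferred from the predicate. *)
Definition ideal_pred (J : set R) (idealJ : ideal J) : {pred R} := fun x => `[< J x >].

Section Quotient.
Variables (J : set R) (idealJ : ideal J).

Fact ideal_pred_zmod_closed : zmod_closed (ideal_pred idealJ).
Proof.
split; first by apply/asboolP; apply: ideal0.
by move=> x y /asboolP Jx /asboolP Jy; apply/asboolP; apply: idealB.
Qed.

HB.instance Definition _ := GRing.isZmodClosed.Build R (ideal_pred idealJ)
  ideal_pred_zmod_closed.

Definition quotient_module : Type := Quotient.quot (ideal_pred idealJ).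
HB.instance Definition _ := Choice.on quotient_module.
HB.instance Definition _ := GRing.Zmodule.on quotient_module.

Definition quotient_pi (x : R) : quotient_module :=
  \pi_(Quotient.quot (ideal_pred idealJ))%qT x.

Let qrepr (u : quotient_module) : R := repr (qT := Quotient.quot (ideal_pred idealJ)) u.

Let qreprK : cancel qrepr quotient_pi.
Proof. exact: (@reprK _ (Quotient.quot (ideal_pred idealJ))). Qed.

Lemma quotient_piP x y : quotient_pi x = quotient_pi y <-> J (x - y).
Proof.
split=> [/eqP h|h]; first by apply/asboolP; move: h; rewrite -Quotient.idealrBE.
by apply/eqP; rewrite -Quotient.idealrBE; apply/asboolP.
Qed.

Lemma quotient_piD : {morph quotient_pi : x y / x + y}.
Proof.
move=> x y; have piB : {morph quotient_pi : x y / x - y}.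
  exact: (@pi_is_zmod_morphism _ _ _ (Quotient.quot (ideal_pred idealJ))).
have pi0 : quotient_pi 0 = 0 by rewrite -(subrr 0) piB subrr.
by rewrite -[y in LHS]opprK piB -[- y]sub0r piB pi0 sub0r opprK.
Qed.

Definition quotient_scale a (u : quotient_module) : quotient_module :=
  quotient_pi (a * qrepr u).

Fact quotient_scale_pi a x : quotient_scale a (quotient_pi x) = quotient_pi (a * x).
Proof.
apply/quotient_piP; rewrite -mulrBr; apply: idealMl => //.
by apply/quotient_piP; rewrite qreprK.
Qed.

Fact quotient_scaleA a b u :
  quotient_scale a (quotient_scale b u) = quotient_scale (a * b) u.
Proof. by rewrite -[u]qreprK !quotient_scale_pi mulrA. Qed.

Fact quotient_scale1 : left_id 1 quotient_scale.
Proof. by move=> u; rewrite -[u]qreprK quotient_scale_pi mul1r. Qed.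

Fact quotient_scaleDr : right_distributive quotient_scale +%R.
Proof.
move=> a u v; rewrite -[u]qreprK -[v]qreprK -quotient_piD !quotient_scale_pi.
by rewrite mulrDr quotient_piD.
Qed.

Fact quotient_scaleDl u : {morph quotient_scale^~ u : a b / a + b}.
Proof.
by move=> a b; rewrite -[u]qreprK !quotient_scale_pi mulrDl quotient_piD.
Qed.

HB.instance Definition _ := GRing.Zmodule_isLmodule.Build R quotient_module
  quotient_scaleA quotient_scale1 quotient_scaleDr quotient_scaleDl.

Lemma scale_quotient_pi a x : a *: quotient_pi x = quotient_pi (a * x).
Proof. exact: quotient_scale_pi. Qed.

Lemma quotient_pi_eq0 x : quotient_pi x = 0 <-> J x.
Proof.
have <- : quotient_pi 0 = 0.
  by apply: (addrI (quotient_pi 0)); rewrite -quotient_piD !addr0.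
by rewrite quotient_piP subr0.
Qed.

Lemma fg_quotient_module : fg_module quotient_module.
Proof.
exists 1%N, (fun=> quotient_pi 1); apply/seteqP; split=> // u _.
exists 1%N, (fun=> qrepr u), (fun=> quotient_pi 1); split; first by exists ord0.
by rewrite big_ord1 scale_quotient_pi mulr1 qreprK.
Qed.

End Quotient.
End QuotientModule.

(** * Cartier maps, Frobenius powers and tensors *)

Section CartierMaps.
Variables (R : comNzRingType) (p : nat).
Implicit Types (I J a b : set R) (phi psi : R -> R).

Lemma cartier_comp e e' phi psi : cartier p e phi -> cartier p e' psi ->
  cartier p (e + e') (phi \o psi).
Proof.
move=> [phiD phiZ] [psiD psiZ]; split=> [r s|s r] /=; first by rewrite psiD phiD.
by rewrite expnD exprM psiZ phiZ.
Qed.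

Lemma cartier_mull e phi c : cartier p e phi -> cartier p e (fun r => phi (c * r)).
Proof.
move=> [phiD phiZ]; split=> [r s|s r]; first by rewrite mulrDr phiD.
by rewrite mulrCA phiZ.
Qed.

Lemma cartier0 e phi : cartier p e phi -> phi 0 = 0.
Proof. by move=> [phiD _]; apply: (addrI (phi 0)); rewrite -phiD !addr0. Qed.

Lemma cartier_ideal e I : ideal I ->
  ideal [set f | forall phi, cartier p e phi -> I (phi f)].
Proof.
move=> iI; split=> [phi cphi|f g If Ig phi cphi|c f If phi cphi].
- by rewrite (cartier0 cphi); apply: ideal0.
- by have [-> _] := cphi; apply: idealD; auto.
- exact: If (cartier_mull c cphi).
Qed.

(** The converse of detection: [phi (y ^ q) = y * phi 1]. *)
Lemma cartier_frob_power e I f phi : ideal I -> frob_power p e I f ->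
  cartier p e phi -> I (phi f).
Proof.
move=> iI If; move: f If phi.
suff: frob_power p e I `<=` [set f | forall phi, cartier p e phi -> I (phi f)] by [].
apply: ispan_min; first exact: cartier_ideal.
by move=> _ [y Iy <-] phi [_ phiZ]; rewrite -[_ ^+ _]mulr1 phiZ; apply: idealMr.
Qed.

Lemma frob_power_ideal e I : ideal (frob_power p e I).
Proof. exact: ispan_ideal. Qed.

Lemma frob_powerS e I J : I `<=` J -> frob_power p e I `<=` frob_power p e J.
Proof. by move=> IJ; apply: ispanS; apply: image_subset. Qed.

Lemma frob_power_mul e I J f g : frob_power p e I f -> frob_power p e J g ->
  frob_power p e (ideal_mul I J) (f * g).
Proof.
apply: ispan_mul; first exact: frob_power_ideal.
move=> _ _ [y Iy <-] [z Jz <-]; rewrite -exprMn; apply: ispan_mem.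
by exists (y * z) => //; apply: ideal_mul_mem.
Qed.

Lemma frob_power_comp e I : p \in [pchar R] ->
  frob_power p 1 (frob_power p e I) `<=` frob_power p e.+1 I.
Proof.
move=> charR; have iI := frob_power_ideal e.+1 I.
apply: ispan_min => // _ [z + <-]; rewrite expn1; move: z.
have p0 : (0 < p)%N by rewrite prime_gt0 // (pcharf_prime charR).
suff: frob_power p e I `<=` [set z | frob_power p e.+1 I (z ^+ p)] by [].
apply: ispan_min => [|_ [y Iy <-] /=]; last first.
  by apply: ispan_mem; exists y; rewrite // expnSr exprM.
split=> /= [|f g If Ig|r f If].
- by rewrite expr0n eqn0Ngt p0; apply: ideal0.
- have -> : (f + g) ^+ p = f ^+ p + g ^+ p.
    exact: (rmorphD (pFrobenius_aut charR)).
  exact: idealD.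
- by rewrite /GRing.scale /= exprMn; apply: idealMl.
Qed.

Lemma tens_r0 e (M : lmodType R) r : tens p e r (0 : M) = 0.
Proof. by apply: (addrI (tens p e r 0)); rewrite -tensDr !addr0. Qed.

Lemma frob_sub0 e (M : lmodType R) (u : frob p e M) :
  frob_sub [set 0 : M] u <-> u = 0.
Proof.
split=> [[n [r [x [x0 ->]]]]|->].
  by rewrite big1 // => i _; rewrite (x0 i) tens_r0.
exists 0%N, (fun=> 0), (fun=> 0); split; first by case.
by rewrite big_ord0.
Qed.

(* A Cartier map [phi] induces [r (x) z |-> phi r *: z] on [F^e(M)].  *)
Lemma cartier_tens0 e (M : lmodType R) phi r (z : M) :
  cartier p e phi -> tens p e r z = 0 -> phi r *: z = 0.
Proof.
move=> [phiD phiZ] rz; pose f s (w : M) := phi s *: w.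
have fDl s t w : f (s + t) w = f s w + f t w by rewrite /f phiD scalerDl.
have fDr s w w' : f s (w + w') = f s w + f s w' by rewrite /f scalerDr.
have fZ t s w : f (t ^+ (p ^ e) * s) w = f s (t *: w).
  by rewrite /f phiZ scalerA mulrC.
have := frob_lift_tens fDl fDr fZ r z; rewrite rz /f => <-.
by rewrite -(subrr (0 : frob p e M)) (frob_liftB fDl fDr fZ) subrr.
Qed.

End CartierMaps.

(** * Test ideals in the complete regular local ring *)

Section RegularRing.
Variables (R : comNzRingType) (p : nat) (m : set R).
Hypotheses (charR : p \in [pchar R]) (regR : regular_local_ring m).
Hypothesis cplR : adically_complete m.
Implicit Types (I J a b : set R).

Let noethR : noetherian R. Proof. by case: regR. Qed.
Let locm : local_ring m. Proof. by case: regR. Qed.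
Let p_gt1 : (1 < p)%N. Proof. by rewrite prime_gt1 // (pcharf_prime charR). Qed.

(** Induction on [e], writing [I^[p^(e+1)]] as an iterated Frobenius power and composing the Cartier
    maps of the two stages. *)
Lemma cartier_detects e I f : ideal I ->
  (forall phi, cartier p e phi -> I (phi f)) -> frob_power p e I f.
Proof.
elim: e I f => [|e IHe] I f iI If.
  apply: ispan_mem; exists f; rewrite ?expr1 //.
  by apply: (If id); split=> // s r; rewrite expr1.
apply: frob_power_comp => //.
have [_ _ [d [chainR _] [x genm]]] := regR.
have [B [indB spanB]] := exists_p_basis charR noethR locm.
apply: (cartier_detects1 charR noethR locm cplR genm chainR indB spanB).
  exact: frob_power_ideal.
move=> phi cphi; apply: IHe => // psi cpsi.
by apply: (If (psi \o phi)); rewrite -addn1; apply: cartier_comp.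
Qed.

(** The bottom of a longest prime chain is a minimal prime, since a smaller prime would lengthen the
    chain; it contains 0. *)
Lemma off_minimal_primes_neq0 (c : R) : off_minimal_primes c -> c <> 0.
Proof.
have [_ _ [d [[P [primeP strictP]] dmax] _]] := regR.
move=> cP c0; apply: (cP (P 0)); last first.
  by rewrite c0; apply: ideal0; case: (primeP 0).
split; first exact: primeP.
move=> Q primeQ QP; apply: contrapT => nQP.
suff /dmax : prime_chain R d.+1 by rewrite ltnn.
exists (fun i => if i is i'.+1 then P i' else Q); split; first by case.
case=> [_|i]; last exact: strictP.
by split=> // PQ; apply: nQP; apply/seteqP.
Qed.

Lemma off_minimal_primes1 : off_minimal_primes (1 : R).
Proof. by move=> P [[]]. Qed.

(* If [x] is not in [J^[q]], then [c] lies in [(J^[q] : x)^[q']], hence in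
   [m^q'], for all large [q'].  *)
Lemma exp_sub_frob_power a J (c : R) e0 : ideal J -> off_minimal_primes c ->
  (forall e, (e0 <= e)%N -> forall x, ideal_exp a (p ^ e) x ->
    frob_power p e J (c * x)) ->
  forall e, ideal_exp a (p ^ e) `<=` frob_power p e J.
Proof.
move=> iJ /off_minimal_primes_neq0 c0 cJ e x ax.
pose I := colon (frob_power p e J) x.
have iI : ideal I by apply/colon_ideal/frob_power_ideal.
have cI e' : (e0 <= e')%N -> frob_power p e' I c.
  move=> e0e'; apply: cartier_detects => // psi cpsi; rewrite /I /colon /=.
  apply: cartier_detects => // phi cphi.
  (* With [q' = p ^ e'], [psi c * x = psi (c * x ^ q')], and [x ^ q'] lies in the power of [a] of
     exponent [p ^ (e + e')], so the hypothesis on [c] applies to the composite [phi \o psi]. *)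
  have [_ psiZ] := cpsi; rewrite mulrC -psiZ mulrC.
  have cphipsi := cartier_comp cphi cpsi.
  apply: (cartier_frob_power iJ _ cphipsi).
  apply: cJ; first by apply: leq_trans e0e' (leq_addl _ _).
  by rewrite expnD; apply: ideal_expX.
have [|I1] := EM (I 1); first by rewrite /I /colon /= mul1r.
case: c0; apply: cplR.1 => n.
have := cI (e0 + n)%N (leq_addr _ _); move: (c).
apply: ispan_min => [|_ [y Iy <-]]; first exact: ideal_exp_ideal.
apply: (@ideal_expW _ _ _ (1 * p ^ (e0 + n))).
  rewrite mul1n; apply: leq_trans (leq_addl e0 n) _.
  by apply: ltnW; apply: ltn_expl.
by apply/ideal_expX/ideal_exp1; apply: (proper_sub_max noethR locm iI I1).
Qed.

(** The annihilator of each element of the tight closure of 0 is good, so the intersection [J0] of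
    all good ideals lies in the test ideal. Detection by Cartier maps passes to intersections, so
    [J0] is itself good. *)
Lemma exp_sub_frob_power_test a e : ideal_exp a (p ^ e) `<=`
  frob_power p e (test_ideal p a).
Proof.
pose good J := ideal J /\ forall e, ideal_exp a (p ^ e) `<=` frob_power p e J.
pose J0 := [set r | forall J, good J -> J r].
have iJ0 : ideal J0.
  split=> [J [iJ _]|x y Jx Jy J gJ|r x Jx J gJ]; first exact: ideal0.
    by apply: (idealD gJ.1); [apply: Jx|apply: Jy].
  by apply: (idealMl _ gJ.1); apply: Jx.
have J0test : J0 `<=` test_ideal p a.
  move=> r J0r M _ z [c cR [e0 cz]].
  pose J := [set s | s *: z = 0].
  suff: good J by move=> /J0r.
  have iJ : ideal J.
    split=> [|s t sz tz|s t tz]; rewrite /J /=; first exact: scale0r.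
      by rewrite scalerDl sz tz addr0.
    by have := scalerA s t z; rewrite tz scaler0 => /esym.
  split=> //; apply: (exp_sub_frob_power iJ cR) => e' e0e' x ax.
  apply: cartier_detects => // phi cphi.
  apply: (cartier_tens0 cphi); have /frob_sub0 := cz e' e0e' x ax.
  by rewrite /frob_elt !scale_tens mulr1.
move=> x ax; apply: frob_powerS J0test _ _; apply: cartier_detects => // phi cphi.
by move=> J [iJ aJ]; apply: (cartier_frob_power iJ _ cphi); apply: aJ.
Qed.

Lemma test_ideal_mul_sub a b :
  test_ideal p (ideal_mul a b) `<=` ideal_mul (test_ideal p a) (test_ideal p b).
Proof.
set J := ideal_mul (test_ideal p a) _ => r rab.
have iJ : ideal J by apply: ideal_mul_ideal.
apply/(quotient_pi_eq0 iJ); rewrite -[r]mulr1 -scale_quotient_pi.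
apply: rab (fg_quotient_module iJ) _ _.
(* The multiplier 1 works for every [q]: [(ab)^q] lies in [a^q b^q], hence in [J^[q]], which kills
   [1 (x) 1] in the Frobenius pullback of [R / J]. *)
exists 1; first exact: off_minimal_primes1.
exists 0%N => e _ x /ideal_exp_mul abx; apply/frob_sub0.
rewrite /frob_elt !scale_tens mul1r mulr1.
have : frob_power p e J x.
  move: abx; apply: ideal_mul_min; first exact: frob_power_ideal.
  move=> y z ay bz; apply: frob_power_mul; exact: exp_sub_frob_power_test.
move=> [n [c [g [gJ ->]]]].
have tens_sum (F : 'I_n -> R) w : tens p e (\sum_i F i) w = \sum_i tens p e (F i) w.
  apply: (big_morph (fun r => tens p e r w)) => [s t|]; first exact: tensDl.
  by apply: (addrI (tens p e 0 w)); rewrite -tensDl !addr0.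
rewrite tens_sum big1 // => i _; have [y Jy <-] := gJ i.
(* The factor [y ^ q] crosses the tensor sign as [y], whose class in [R / J] vanishes. *)
rewrite /GRing.scale /= mulrC tens_frob scale_quotient_pi mulr1.
by have /(quotient_pi_eq0 iJ) -> := Jy; rewrite tens_r0.
Qed.

End RegularRing.

Theorem theorem4p5 (R : comNzRingType) (p : nat) (m : set R)
    (charR : p \in [pchar R]) (regR : regular_local_ring m)
    (cplR : adically_complete m)
    (a b : set R) (ideala : ideal a) (idealb : ideal b) :
  test_ideal p (ideal_mul a b) `<=`
    ideal_mul (test_ideal p a) (test_ideal p b).
Proof. exact: test_ideal_mul_sub charR regR cplR a b. Qed.
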